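(* Let $\mathbb X$ and $\mathbb Y$ be (real or complex) Hilbert spaces, $\Omega\subseteq\mathbb X$ an open set, and $F:\Omega\to\mathbb Y$ a continuously differentiable function such that $F'(x)$ has closed image for every $x\in\Omega$. Let $x_*\in\Omega$, $R>0$, $\beta:=\|F'(x_* )^{\dagger}\|$ and $\kappa:=\sup\{t\in[0,R): B(x_*,t)\subset\Omega\}$. Suppose that $F(x_* )=0$, that $F'(x_* )$ is injective, and that there exists a positive integrable function $L:[0,R)\to\mathbb R$ such that $$\beta\,\|F'(x)-F'(x_*+\tau(x-x_* ))\|\le\int_{\tau\|x-x_*\|}^{\|x-x_*\|}L(u)\,du$$ for all $\tau\in[0,1]$ and $x\in B(x_*,\kappa)$. Define the positive constants $$\bar\nu:=\sup\Big\{t\in[0,R):\int_0^tL(u)\,du-1<0\Big\},$$ $$\bar\rho:=\sup\Big\{\delta\in(0,\bar\nu):\frac{\int_0^tL(u)u\,du}{t\big(1-\int_0^tL(u)\,du\big)}<1\ \text{ for all } t\in(0,\delta)\Big\},\qquad \bar r:=\min\{\kappa,\bar\rho\},$$ $$\bar\sigma:=\sup\Big\{t\in(0,\kappa):\int_0^tL(u)(t-u)\,du-t<0\Big\}.$$ Let $x_0\in B(x_*,\bar r)\setminus\{x_*\}$ and $t_0=\|x_0-x_*\|$. Then the sequences $\{x_k\}$ and $\{t_k\}$ given by $$x_{k+1}=x_k-F'(x_k)^{\dagger}F(x_k),\qquad t_{k+1}=\frac{\int_0^{t_k}L(u)u\,du}{1-\int_0^{t_k}L(u)\,du},\qquad k=0,1,\ldots,$$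 are well defined; $\{t_k\}$ is strictly decreasing, contained in $(0,\bar r)$ and converges to $0$. Furthermore, $\{x_k\}$ is contained in $B(x_*,\bar r)$ and converges to $x_*$, which is the unique zero of $F$ in $B(x_*,\bar\sigma)$, and $$\lim_{k\to\infty}\frac{t_{k+1}}{t_k}=0,\qquad\lim_{k\to\infty}\frac{\|x_{k+1}-x_*\|}{\|x_k-x_*\|}=0.$$ Moreover, if $$\frac{\int_0^{\bar\rho}L(u)u\,du}{\bar\rho\big(1-\int_0^{\bar\rho}L(u)\,du\big)}=1$$ and $\bar\rho<\kappa$, then $\bar r=\bar\rho$ is the best possible convergence radius; that is, for the same $R$, $L$ and $\kappa$ there exist Hilbert spaces, an open set, a function and a zero of it satisfying all the hypotheses above, together with a starting point at distance exactly $\bar\rho$ from that zero, for which the sequence $\{x_k\}$ does not converge. If, additionally, for a given $0\le p\le1$, the function $(0,\bar\nu)\ni t\mapsto t^{1-p}L(t)$ is nondecreasing, then the sequence $\{t_{k+1}/t_k^{p+1}\}$ is strictly decreasing and $$\|x_{k+1}-x_*\|\le\big[t_{k+1}/t_k^{p+1}\big]\|x_k-x_*\|^{p+1}\le\big[t_1/t_0^{p+1}\big]\|x_k-x_*\|^{p+1},\qquad k=0,1,\ldots.$$ Consequently, for all $k\ge0$, $\|x_k-x_*\|\le t_0[t_1/t_0]^k$ if $p=0$, and $\|x_k-x_*\|\le t_0[t_1/t_0]^{((p+1)^k-1)/p}$ if $p\ne0$.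
   Context: $B(a,\delta)=\{x:\|x-a\|<\delta\}$ denotes the open ball. For a continuous injective linear operator $A:\mathbb X\to\mathbb Y$ with closed image, the Moore-Penrose inverse is $A^{\dagger}:=(A^*A)^{-1}A^*$, where $A^*$ is the adjoint. The quotient $\|x_{k+1}-x_*\|/\|x_k-x_*\|$ is read as $0$ if $x_k=x_*$ (in that case $x_{k+1}=x_*$ too). *)

(* Defs.v *)
From HB Require Import structures.
From mathcomp Require Import all_boot all_order all_algebra.
From mathcomp Require Import sesquilinear complex.
From mathcomp Require Import all_classical all_reals all_analysis.

Set Implicit Arguments.
Unset Strict Implicit.
Unset Printing Implicit Defensive.

Import Order.TTheory GRing.Theory Num.Theory.
Import numFieldNormedType.Exports.

Local Open Scope classical_set_scope.
Local Open Scope ring_scope.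

Variant scalar_kind := RealScalars | ComplexScalars.

Definition scalars (R : realType) (s : scalar_kind) : numFieldType :=
  match s with RealScalars => R | ComplexScalars => R[i] end.

Definition scalar_conj (R : realType) (s : scalar_kind) :
    scalars R s -> scalars R s :=
  match s with RealScalars => idfun | ComplexScalars => @conjc R end.

Definition scalar_re (R : realType) (s : scalar_kind) : scalars R s -> R :=
  match s with RealScalars => idfun | ComplexScalars => @complex.Re R end.

Definition scalar_of (R : realType) (s : scalar_kind) : R -> scalars R s :=
  match s with RealScalars => idfun | ComplexScalars => fun x => (x%:C)%C end.
Arguments scalar_of {R} s.

(* The inner product is linear in its first argument. *)
Record hilbertType (R : realType) (s : scalar_kind) := HilbertType {
  hilbert_sort :> completeNormedModType (scalars R s) ;
  inner : {dot hilbert_sort for @scalar_conj R s} ;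
  innerxx : forall x : hilbert_sort, inner x x = `|x| ^+ 2
}.

Section Operators.
Variables (R : realType) (s : scalar_kind).

(* The norm of the library takes its values in the scalars, hence in R[i] for a
   complex space. *)
Definition rnorm (X : hilbertType R s) (x : X) : R := scalar_re `|x|.

Definition oball (X : hilbertType R s) (a : X) (delta : R) : set X :=
  [set x | rnorm (x - a) < delta].

Definition opnorm (X Y : hilbertType R s) (A : X -> Y) : R :=
  sup [set rnorm (A x) | x in [set x : X | rnorm x <= 1]].

Definition adjoint (X Y : hilbertType R s) (A : X -> Y) (y : Y) : X :=
  xget 0 [set z | forall x, inner Y (A x) y = inner X x z].

Definition op_inv (X : hilbertType R s) (B : X -> X) (y : X) : X :=
  xget 0 [set x | B x = y].

(* Meaningful for A continuous, linear, injective and with closed image: then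
   the adjoint exists and adjoint A \o A is bijective. *)
Definition moore_penrose (X Y : hilbertType R s) (A : X -> Y) : Y -> X :=
  op_inv (adjoint A \o A) \o adjoint A.

Definition C1_on (X Y : hilbertType R s) (Omega : set X) (F : X -> Y) : Prop :=
  (forall x, Omega x -> differentiable F x) /\
  (forall x, Omega x ->
     opnorm (fun h => 'd F y h - 'd F x h) @[y --> x] --> (0 : R)).

End Operators.

Section Constants.
Variable R : realType.
Implicit Types (L : R -> R) (rad t : R).

Local Notation mu := (@lebesgue_measure R).

Definition intL L (a b : R) : R := \int[mu]_(u in `[a, b]) L u.

Definition intLu L t : R := \int[mu]_(u in `[0, t]) (L u * u).

Definition kappa s (X : hilbertType R s) rad (Omega : set X) (xs : X) : R :=
  sup [set t | 0 <= t < rad /\ oball xs t `<=` Omega].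

Definition nu L rad : R := sup [set t | 0 <= t < rad /\ intL L 0 t - 1 < 0].

Definition rho L rad : R :=
  sup [set delta | 0 < delta < nu L rad /\
         forall t, 0 < t < delta -> intLu L t / (t * (1 - intL L 0 t)) < 1].

Definition sigma L (kap : R) : R :=
  sup [set t | 0 < t < kap /\
         (\int[mu]_(u in `[0, t]) (L u * (t - u))) - t < 0].

Definition majorant_seq L (t0 : R) (k : nat) : R :=
  iter k (fun t => intLu L t / (1 - intL L 0 t)) t0.

(* F and L are total functions; only the values of F on Omega and those of L on
   [0, rad[ matter. *)
Record newton_hyp s (X Y : hilbertType R s) (Omega : set X) (F : X -> Y)
    (xs : X) rad L : Prop := NewtonHyp {
  Omega_open : open Omega ;
  F_C1 : C1_on Omega F ;
  dF_closed : forall x, Omega x -> closed (range ('d F x)) ;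
  xs_Omega : Omega xs ;
  rad_gt0 : 0 < rad ;
  F_xs : F xs = 0 ;
  dF_xs_inj : injective ('d F xs) ;
  L_gt0 : forall u, 0 <= u < rad -> 0 < L u ;
  L_integrable : mu.-integrable `[0, rad[ (EFin \o L) ;
  L_lipschitz : forall (tau : R) (x : X), 0 <= tau <= 1 ->
    oball xs (kappa rad Omega xs) x ->
    opnorm (moore_penrose ('d F xs)) *
      opnorm (fun h => 'd F x h - 'd F (xs + scalar_of s tau *: (x - xs)) h)
    <= intL L (tau * rnorm (x - xs)) (rnorm (x - xs))
}.

(* Total, hence possibly meaningless from some index on: see
   gauss_newton_defined. *)
Definition gauss_newton s (X Y : hilbertType R s) (F : X -> Y) (x0 : X)
    (k : nat) : X :=
  iter k (fun x => x - moore_penrose ('d F x) (F x)) x0.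

Definition gauss_newton_defined s (X Y : hilbertType R s) (Omega : set X)
    (F : X -> Y) (x0 : X) : Prop :=
  forall k, Omega (gauss_newton F x0 k) /\
            injective ('d F (gauss_newton F x0 k)).

End Constants.

(* Main.v *)
Require Import Defs.
From HB Require Import structures.
From mathcomp Require Import all_boot all_order all_algebra.
From mathcomp Require Import sesquilinear complex.
From mathcomp Require Import all_classical all_reals all_analysis.
From mathcomp Require Import ring lra.

Set Implicit Arguments.
Unset Strict Implicit.
Unset Printing Implicit Defensive.

Import Order.TTheory GRing.Theory Num.Theory.
Import numFieldNormedType.Exports.

Local Open Scope classical_set_scope.
Local Open Scope ring_scope.

(** Notation: xs is the zero of F, beta the norm of the Moore-Penrose inverse of
    F'(xs), I t = \int_0^t L, J t = \int_0^t L(u) u du, and n t = J t / (1 - I t)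
    the map generating the majorant sequence.

    An injective operator A with closed range is bounded below
    ([closed_range_bounded_below]), so its Moore-Penrose inverse gives
    least-squares solutions ([rinner_moore_penrose]), and |h| <= beta |F'(xs) h|.
    For x = xs + v the hypothesis with tau = 0 then yields
    (1 - I |v|) |h| <= beta |F'(x) h| ([dF_bounded_below]): F'(x) is injective as
    long as I |v| < 1, which holds for |v| below nu.

    The mean value inequality on the segment from xs to x, applied to F minus the
    linear map F'(x), gives beta |F x - F'(x) v| <= J |v|
    ([linearization_error]). A least-squares solution does not increase the
    residual, so the Gauss-Newton step at x lands at distance at most n |v| from
    xs ([gauss_newton_step]). Below rho one has 0 < n t < t, and n is monotone;
    hence t_k decreases to the only fixed point 0 and |x_k - xs| <= t_k by
    induction ([gauss_newton_le]). Since J t <= t I t, the quotient n t / t is at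
    most I t / (1 - I t), which tends to 0 and gives both superlinear limits.

    Uniqueness is the same argument with F'(xs) in place of F'(x): a zero xs + v
    satisfies |v| <= |v| I |v| - J |v|, and the right-hand side is less than |v|
    below sigma by convexity ([zero_unique]).

    If t^(1-p) L t is nondecreasing, then J t / t^(p+1) is nondecreasing
    ([intLu_powR_scale]), so n t / t^(p+1) is strictly increasing, and the rates
    follow from |x_(k+1) - xs| <= n |x_k - xs| and |x_k - xs| <= t_k.

    For optimality, the odd function on the line equal to x - (x I x - J x) for
    x >= 0 has derivative 1 - I |x|; all the estimates become equalities, one step
    sends x to - n x for x >= 0, and n rho = rho makes the iterates started at rho
    alternate between rho and - rho ([sharp_divergence]). *)

(** * The real structure of a Hilbert space *)

Section RealStructure.
Variables (R : realType) (s : scalar_kind).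

Lemma scalar_ofD (a b : R) : scalar_of s (a + b) = scalar_of s a + scalar_of s b.
Proof. by case: s => //=; rewrite rmorphD. Qed.

Lemma scalar_ofM (a b : R) : scalar_of s (a * b) = scalar_of s a * scalar_of s b.
Proof. by case: s => //=; rewrite rmorphM. Qed.

Lemma scalar_of1 : scalar_of s (1 : R) = 1.
Proof. by case: s. Qed.

Lemma scalar_of0 : scalar_of s (0 : R) = 0.
Proof. by case: s. Qed.

Lemma scalar_ofN (a : R) : scalar_of s (- a) = - scalar_of s a.
Proof. by case: s => //=; rewrite rmorphN. Qed.

Lemma scaleN1r_real (X : hilbertType R s) (x : X) : scalar_of s (-1) *: x = - x.
Proof. by rewrite scalar_ofN scalar_of1 scaleN1r. Qed.

Lemma scalar_of_norm (a : R) : `|scalar_of s a| = scalar_of s `|a|.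
Proof. by case: s => //=; rewrite normc_def /= expr0n /= addr0 sqrtr_sqr. Qed.

Lemma ler_scalar_of (a b : R) : (scalar_of s a <= scalar_of s b) = (a <= b).
Proof. by case: s => //=; rewrite lecR. Qed.

Lemma ltr_scalar_of (a b : R) : (scalar_of s a < scalar_of s b) = (a < b).
Proof. by case: s => //=; rewrite ltcR. Qed.

Lemma scalar_ofK (a : R) : scalar_re (scalar_of s a) = a.
Proof. by case: s. Qed.

(** A nonnegative complex number is real, so norms and radii of balls live in R
    for both kinds of scalars. *)
Lemma ge0_scalarE (z : scalars R s) : 0 <= z -> z = scalar_of s (scalar_re z).
Proof.
case: s z => //= -[a b]; rewrite lecE /= => /andP[/eqP-> _]. by [].
Qed.

Lemma scalar_reD (a b : scalars R s) :
  scalar_re (a + b) = scalar_re a + scalar_re b.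
Proof. by case: s a b => //= -[a b] [c d]. Qed.

Lemma scalar_reZ (a : R) (z : scalars R s) :
  scalar_re (scalar_of s a * z) = a * scalar_re z.
Proof. by case: s z => //= -[b c] /=; rewrite mul0r subr0. Qed.

Section Space.
Variable X : hilbertType R s.
Implicit Types (x y z : X) (a : R).

Lemma normE x : `|x| = scalar_of s (rnorm x).
Proof. exact: ge0_scalarE. Qed.

Lemma rnorm_ge0 x : 0 <= rnorm x.
Proof. by rewrite -ler_scalar_of -normE scalar_of0. Qed.

Lemma rnorm0 : rnorm (0 : X) = 0.
Proof. by rewrite /rnorm normr0 -scalar_of0 scalar_ofK. Qed.

Lemma rnorm_eq0 x : (rnorm x == 0) = (x == 0).
Proof.
apply/eqP/eqP => [h|->]; last exact: rnorm0.
by apply/eqP; rewrite -normr_eq0 normE h scalar_of0.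
Qed.

Lemma rnorm_gt0 x : (0 < rnorm x) = (x != 0).
Proof. by rewrite lt_def rnorm_eq0 rnorm_ge0 andbT. Qed.

Lemma rnormN x : rnorm (- x) = rnorm x.
Proof. by rewrite /rnorm normrN. Qed.

Lemma rdistC x y : rnorm (x - y) = rnorm (y - x).
Proof. by rewrite -rnormN opprB. Qed.

Lemma ler_rnormD x y : rnorm (x + y) <= rnorm x + rnorm y.
Proof. by rewrite -ler_scalar_of scalar_ofD -!normE ler_normD. Qed.

Lemma ler_rdistD z x y : rnorm (x - y) <= rnorm (x - z) + rnorm (z - y).
Proof. by rewrite -{1}(subrK z x) -addrA ler_rnormD. Qed.

Lemma rnormZ a x : rnorm (scalar_of s a *: x) = `|a| * rnorm x.
Proof. by rewrite {1}/rnorm normrZ scalar_of_norm normE -scalar_ofM scalar_ofK. Qed.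

Lemma nbhs_oball x (A : set X) :
  nbhs x A <-> exists2 e : R, 0 < e & oball x e `<=` A.
Proof.
split.
  move=> /nbhs_ballP[e /= e0 h].
  have eE := ge0_scalarE (ltW e0).
  exists (scalar_re e); first by rewrite -ltr_scalar_of scalar_of0 -eE.
  move=> y hy; apply: h; rewrite -ball_normE /= eE normE ltr_scalar_of rdistC.
  exact: hy.
move=> [e e0 h]; apply/nbhs_ballP; exists (scalar_of s e).
  by rewrite /= -(scalar_of0 ) ltr_scalar_of.
move=> y; rewrite -ball_normE /= normE ltr_scalar_of rdistC => hy; exact: h.
Qed.

Lemma cvg_oball {T : Type} (G : set_system T) {FG : Filter G} (u : T -> X) x :
  u @ G --> x <-> forall e : R, 0 < e -> \forall n \near G, rnorm (u n - x) < e.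
Proof.
split=> [h e e0|h A].
  by apply: (h [set y | rnorm (y - x) < e]); apply/nbhs_oball; exists e.
by move=> /nbhs_oball[e e0 eA]; near=> n; apply: eA; near: n; exact: h.
Unshelve. all: by end_near. Qed.

Lemma rnorm_complete (u : nat -> X) :
  (forall e : R, 0 < e -> exists N, forall m n, (N <= m)%N -> (N <= n)%N ->
     rnorm (u m - u n) < e) ->
  exists x, u @ \oo --> x.
Proof.
move=> h; suff : cvg (u @ \oo) by move=> c; exists (lim (u @ \oo)).
apply/cauchy_cvgP/cauchy_ballP => e e0.
have eE := ge0_scalarE (ltW e0).
have [N hN] := h (scalar_re e) ltac:(by rewrite -ltr_scalar_of scalar_of0 -eE).
exists (u @` [set n | (N <= n)%N], u @` [set n | (N <= n)%N]) => /=.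
  by split; exists N => // n /= Nn; exists n.
move=> [_ _] /= [[m Nm <-] [n Nn <-]].
by rewrite -ball_normE /= eE normE ltr_scalar_of; apply: hN.
Qed.

(** The real part alone determines the inner product of a complex space and
    has the same norm; working with it treats real and complex spaces at once. *)
Definition rinner x y : R := scalar_re (inner X x y).

Lemma rinnerxx x : rinner x x = rnorm x ^+ 2.
Proof. by rewrite /rinner innerxx normE expr2 -scalar_ofM scalar_ofK expr2. Qed.

Lemma rinnerC x y : rinner x y = rinner y x.
Proof.
rewrite /rinner; case: s X x y => /= X' x y.
  by have := hermC (inner X') x y; rewrite expr0 mul1r.
have := hermC (inner X') x y; rewrite expr0 mul1r => ->.
suff reJ (z : R[i]) : complex.Re (conjc z) = complex.Re z by exact: reJ.
by case: z.
Qed.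

Lemma rinnerDl x y z : rinner (x + y) z = rinner x z + rinner y z.
Proof. by rewrite /rinner linearDl scalar_reD. Qed.

Lemma rinnerDr x y z : rinner z (x + y) = rinner z x + rinner z y.
Proof. by rewrite !(rinnerC z) rinnerDl. Qed.

Lemma rinnerZl a x z : rinner (scalar_of s a *: x) z = a * rinner x z.
Proof. by rewrite /rinner linearZl_LR scalar_reZ. Qed.

Lemma rinnerZr a x z : rinner z (scalar_of s a *: x) = a * rinner z x.
Proof. by rewrite !(rinnerC z) rinnerZl. Qed.

End Space.
End RealStructure.

(** * Integrals of the majorant *)

Section MajorantIntegrals.
Variables (R : realType) (L : R -> R) (rad : R).
Local Notation mu := (@lebesgue_measure R).
Hypothesis L_gt0 : forall u, 0 <= u < rad -> 0 < L u.
Hypothesis L_int : mu.-integrable `[0, rad[ (EFin \o L).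

Lemma L_integrableS a b : 0 <= a -> b < rad ->
  mu.-integrable `[a, b] (EFin \o L).
Proof.
move=> a0 br; apply: integrableS L_int => //.
by apply: subset_itv; rewrite bnd_simp.
Qed.

(** The integrands of the constants are products of L, which may be
    unbounded, with a function bounded on the interval. *)
Lemma integrableM_bounded (f h : R -> R) (M a b : R) :
  mu.-integrable `[a, b] (EFin \o f) -> measurable_fun setT h ->
  (forall u, a <= u <= b -> `|h u| <= M) ->
  mu.-integrable `[a, b] (EFin \o (fun u => f u * h u)).
Proof.
move=> fi mh hM.
apply: (@integrableMl _ (measurableTypeR R) R mu `[a, b] _ (EFin \o f) h) => //.
  exact: measurable_funTS.
exists M; split; first exact: num_real.
move=> y My u /=; rewrite in_itv/= => uab.
exact: le_trans (hM u uab) (ltW My).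
Qed.

Lemma integrableZ_itv (f : R -> R) (k a b : R) :
  mu.-integrable `[a, b] (EFin \o f) ->
  mu.-integrable `[a, b] (EFin \o (fun u => k * f u)).
Proof.
move=> fi; have -> : (fun u => k * f u) = (fun u => f u * k).
  by apply/funext => u; exact: mulrC.
exact: (@integrableM_bounded _ _ `|k|).
Qed.

Lemma Lu_integrableS a b : 0 <= a -> b < rad ->
  mu.-integrable `[a, b] (EFin \o (fun u => L u * u)).
Proof.
move=> a0 br; apply: (@integrableM_bounded _ _ b) => //.
  exact: L_integrableS.
by move=> u /andP[au ub]; rewrite ger0_norm// (le_trans a0).
Qed.

Lemma Rintegral_chasles (f : R -> R) a b c : a <= b -> b <= c ->
  mu.-integrable `[a, c] (EFin \o f) ->
  \int[mu]_(u in `[a, c]) f u =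
  \int[mu]_(u in `[a, b]) f u + \int[mu]_(u in `[b, c]) f u.
Proof.
move=> ab bc fi; apply/eqP; rewrite addrC -subr_eq; apply/eqP.
rewrite Rintegral_itvB ?bnd_simp// Rintegral_itv_obnd_cbnd//.
by apply: integrableS fi => //; apply: subset_itv; rewrite bnd_simp.
Qed.

Lemma intL_chasles a b c : 0 <= a -> a <= b -> b <= c -> c < rad ->
  intL L a c = intL L a b + intL L b c.
Proof.
by move=> a0 ab bc cr; apply: Rintegral_chasles => //; exact: L_integrableS.
Qed.

Lemma intLxx a : intL L a a = 0.
Proof. by rewrite /intL set_itv1 Rintegral_set1. Qed.

(** A positive function with zero integral would vanish almost everywhere on a
    set of positive measure. *)
Lemma Rintegral_itv_gt0 (f : R -> R) a b : a < b ->
  mu.-integrable `[a, b] (EFin \o f) -> (forall u, a < u <= b -> 0 < f u) ->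
  0 < \int[mu]_(u in `[a, b]) f u.
Proof.
move=> ab fi f0.
have fi' : mu.-integrable `]a, b] (EFin \o f).
  by apply: integrableS fi => //; apply: subset_itv; rewrite bnd_simp.
rewrite -Rintegral_itv_obnd_cbnd// lt_def.
rewrite Rintegral_ge0; last first.
  by move=> u /=; rewrite in_itv/= => /f0/ltW.
rewrite andbT; apply/eqP => f_eq0.
have mf := measurable_int _ fi'.
have f_abs0 : (\int[mu]_(u in `]a, b]) `|(EFin \o f) u| = 0)%E.
  rewrite -[RHS]/(0%:E) -f_eq0 /Rintegral fineK; last exact: integrable_fin_num.
  apply: eq_integral => u /[!inE]/=; rewrite in_itv/= => /f0/ltW u0.
  by rewrite ger0_norm.
have [N [mN N0 sN]] : ae_eq mu `]a, b]%classic (EFin \o f) (cst 0%E).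
  by apply/(ae_eq_integral_abs mu) => //; exact: measurable_itv.
have : (mu `]a, b] <= mu N)%E.
  apply: le_measure; rewrite ?inE// => u uab; apply: sN => /= /(_ uab) [fu0].
  by move: uab; rewrite /= in_itv/= => /f0; rewrite fu0 ltxx.
rewrite [X in (_ <= X)%E]N0 lebesgue_measure_itv/= lte_fin ab -EFinB lee_fin.
by rewrite subr_le0 leNgt ab.
Qed.

Lemma intL_gt0 a b : 0 <= a -> a < b -> b < rad -> 0 < intL L a b.
Proof.
move=> a0 ab br; apply: Rintegral_itv_gt0 => // [|u /andP[au ub]].
  exact: L_integrableS.
by apply: L_gt0; rewrite (le_lt_trans ub br) (le_trans a0 (ltW au)).
Qed.

Lemma intL_ge0 a b : 0 <= a -> a <= b -> b < rad -> 0 <= intL L a b.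
Proof.
move=> a0; rewrite le_eqVlt => /predU1P[->|ab] br; first by rewrite intLxx.
exact/ltW/intL_gt0.
Qed.

Lemma intLu_gt0 t : 0 < t < rad -> 0 < intLu L t.
Proof.
move=> /andP[t0 tr]; apply: Rintegral_itv_gt0 => // [|u /andP[u0 ut]].
  exact: Lu_integrableS.
by rewrite mulr_gt0// L_gt0// (ltW u0) (le_lt_trans ut).
Qed.

Lemma intLu0 : intLu L 0 = 0.
Proof. by rewrite /intLu set_itv1 Rintegral_set1. Qed.

Lemma intLu_itv a b : 0 <= a -> a <= b -> b < rad ->
  intLu L b - intLu L a = \int[mu]_(u in `[a, b]) (L u * u).
Proof.
move=> a0 ab br; rewrite /intLu (@Rintegral_chasles _ 0 a b)//.
  by rewrite addrC addKr.
exact: Lu_integrableS.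
Qed.

(** These two bounds replace differentiation of t |-> \int_0^t L(u) u du, which
    is available only almost everywhere for an integrable L, and the exchange
    of integrals in \int_0^1 \int_{t r}^r L(u) du dt. The error bounds for F
    use the first moment of L only through them. *)
Lemma intLu_itv_bounds a b : 0 <= a -> a <= b -> b < rad ->
  a * intL L a b <= intLu L b - intLu L a <= b * intL L a b.
Proof.
move=> a0 ab br; rewrite intLu_itv// /intL.
have Li := L_integrableS a0 br.
have Lui := Lu_integrableS a0 br.
have Lk k := integrableZ_itv k Li.
rewrite -!RintegralZl//; apply/andP; split; apply: le_Rintegral => // u /=;
  rewrite in_itv/= => /andP[au ub];
  [rewrite mulrC|rewrite [leRHS]mulrC]; rewrite ler_pM2l//;
  by apply: L_gt0; rewrite (le_trans a0 au) (le_lt_trans ub).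
Qed.

Lemma intL_mul_sub t : 0 <= t -> t < rad ->
  \int[mu]_(u in `[0, t]) (L u * (t - u)) = t * intL L 0 t - intLu L t.
Proof.
move=> t0 tr.
have Li := L_integrableS (lexx 0) tr.
have Lui := Lu_integrableS (lexx 0) tr.
have Lk : mu.-integrable `[0, t] (EFin \o (fun u => L u * t)).
  exact: (@integrableM_bounded _ _ `|t|).
rewrite mulrC /intL -RintegralZr// /intLu -RintegralB//.
by apply: eq_Rintegral => u _; rewrite mulrBr.
Qed.

Lemma intL0_homo a b : 0 <= a -> a <= b -> b < rad -> intL L 0 a <= intL L 0 b.
Proof.
move=> a0 ab br; rewrite (intL_chasles (lexx 0) a0 ab br).
by rewrite lerDl intL_ge0.
Qed.

Lemma intL_continuous t e : 0 <= t -> t < rad -> 0 < e ->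
  exists2 d, 0 < d & forall u, 0 <= u -> u < rad -> `|u - t| < d ->
    `|intL L 0 u - intL L 0 t| < e.
Proof.
move=> t0 tr e0; set b := (t + rad) / 2.
have tb : t < b by rewrite /b; lra.
have br : b < rad by rewrite /b; lra.
have b0 : 0 < b by lra.
have := @parameterized_integral_continuous R 0 b L (ltW b0)
  (L_integrableS (lexx 0) br).
move=> /subspace_continuousP/(_ t).
rewrite /= in_itv/= t0 (ltW tb) => /(_ isT).
move=> /cvgrPdist_lt/(_ e e0); rewrite near_withinE => -[d /= d0 hd].
exists (Num.min d (b - t)); first by rewrite lt_min d0 subr_gt0.
move=> u u0 ur; rewrite lt_min => /andP[ud ub].
rewrite distrC; apply: (hd u); first by rewrite /= distrC.
by rewrite /= in_itv/= u0; move: ub; rewrite ltr_norml => /andP[_]; lra.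
Qed.

End MajorantIntegrals.

(** * Comparison of moments under a power weight *)

Section PowerScaling.
Variable R : realType.
Local Notation mu := (@lebesgue_measure R).

Lemma cvg_powR_at_right0 (p : R) : 0 <= p ->
  (u `^ p) @[u --> 0^'+] --> (0 : R) `^ p.
Proof.
rewrite le_eqVlt => /predU1P[<-|p0].
  rewrite powRr0; under eq_fun do rewrite powRr0.
  exact: cvg_cst.
by rewrite powR0 ?gt_eqF//; exact: powR_cvg0.
Qed.

Lemma continuous_powR (p x : R) : 0 < x -> {for x, continuous (@powR R ^~ p)}.
Proof.
move=> x0; apply/differentiable_continuous/derivable1_diffP.
by apply: derivable_powR; rewrite in_itv/= x0.
Qed.

Lemma within_continuous_powR (p b : R) : 0 <= p -> 0 < b ->
  {within `[0, b], continuous (@powR R ^~ p)}.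
Proof.
move=> p0 b0; apply/(continuous_within_itvP _ b0); split.
- by move=> x; rewrite in_itv/= => /andP[x0 _]; exact: continuous_powR.
- exact: cvg_powR_at_right0.
- by apply: cvg_at_left_filter; exact: continuous_powR.
Qed.

Lemma integrable_powR (p b : R) : 0 <= p -> 0 < b ->
  mu.-integrable `[0, b] (EFin \o (@powR R ^~ p)).
Proof.
move=> p0 b0; apply: continuous_compact_integrable; first exact: segment_compact.
exact: within_continuous_powR.
Qed.

Lemma Rintegral_powR0 (p b : R) : 0 <= p -> 0 < b ->
  \int[mu]_(u in `[0, b]) (u `^ p) = b `^ (p + 1) / (p + 1).
Proof.
move=> p0 b0; have p1 : 0 < p + 1 by lra.
rewrite /Rintegral (@continuous_FTC2 _ _ (fun u => u `^ (p + 1) / (p + 1)))//.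
- by rewrite /= powR0 ?gt_eqF// mul0r subr0.
- exact: within_continuous_powR.
- split.
  + move=> x; rewrite in_itv/= => /andP[x0 _].
    apply: derivableM => //; apply: derivable_powR.
    by rewrite in_itv/= x0.
  + by apply: cvgMl; exact/cvg_powR_at_right0/ltW.
  + by apply: cvgMl; apply: cvg_at_left_filter; exact: continuous_powR.
- move=> x; rewrite in_itv/= => /andP[x0 _].
  have dp : is_derive x 1 (@powR R ^~ (p + 1)) ((p + 1) * x `^ (p + 1 - 1)).
    exact: is_derive1_powR.
  rewrite derive1E deriveMr; [|exact: ex_derive].
  by rewrite derive_val addrK mulKf// gt_eqF.
Qed.

Lemma Rintegral_powR (p a b : R) : 0 <= p -> 0 < a -> a < b ->
  \int[mu]_(u in `[a, b]) (u `^ p) = (b `^ (p + 1) - a `^ (p + 1)) / (p + 1).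
Proof.
move=> p0 a0 ab; have b0 := lt_trans a0 ab.
have := @Rintegral_chasles R (@powR R ^~ p) 0 a b (ltW a0) (ltW ab)
  (integrable_powR p0 b0).
by rewrite !Rintegral_powR0// => E; rewrite mulrBl E addrAC subrr add0r.
Qed.

Variables (L : R -> R) (rad : R).
Hypothesis L_gt0 : forall u, 0 <= u < rad -> 0 < L u.
Hypothesis L_int : mu.-integrable `[0, rad[ (EFin \o L).

(** On [0, a] the integrand u L(u) = (u^(1-p) L(u)) u^p is at most
    a^(1-p) L(a) u^p, and on [a, b] it is at least that; integrating u^p
    exactly on both intervals gives the comparison. Equivalently, the first
    moment of L over [0, t] divided by t^(p+1) is nondecreasing. *)
Lemma intLu_powR_scale (p nu a b : R) : 0 <= p <= 1 -> nu <= rad ->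
  (forall u v : R, 0 < u -> u <= v -> v < nu ->
    u `^ (1 - p) * L u <= v `^ (1 - p) * L v) ->
  0 < a -> a < b -> b < nu ->
  b `^ (p + 1) * intLu L a <= a `^ (p + 1) * intLu L b.
Proof.
move=> /andP[p0 p1] nr Lmono a0 ab bnu.
have b0 := lt_trans a0 ab.
have br : b < rad by exact: lt_le_trans nr.
have ar := lt_trans ab br.
have q0 : 0 < p + 1 by lra.
set M := a `^ (1 - p) * L a.
have powRE u : 0 < u -> u `^ (1 - p) * L u * u `^ p = L u * u.
  move=> u0; rewrite mulrAC -powRD; last by rewrite (gt_eqF u0) implybT.
  by rewrite subrK powRr1 ?ltW// mulrC.
have ia : mu.-integrable `[0, a] (EFin \o (fun u => M * u `^ p)).
  exact/integrableZ_itv/integrable_powR.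
have powR_ab : mu.-integrable `[a, b] (EFin \o (@powR R ^~ p)).
  apply: integrableS (integrable_powR p0 b0) => //.
  by apply: subset_itv; rewrite bnd_simp// ltW.
have ib := integrableZ_itv M powR_ab.
have Ja : intLu L a <= M * (a `^ (p + 1) / (p + 1)).
  rewrite -Rintegral_powR0// -RintegralZl//; last exact: integrable_powR.
  apply: le_Rintegral => //; first exact: (Lu_integrableS L_int).
  move=> u /=; rewrite in_itv/= le_eqVlt => /andP[/predU1P[<- _|u0 ua]].
    by rewrite mulr0 mulr_ge0 ?powR_ge0// mulr_ge0 ?powR_ge0// ltW// L_gt0// ltW.
  by rewrite -powRE// ler_wpM2r ?powR_ge0// Lmono// (lt_trans ab).
have Jb : M * ((b `^ (p + 1) - a `^ (p + 1)) / (p + 1)) <= intLu L b - intLu L a.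
  rewrite (intLu_itv L_int (ltW a0) (ltW ab) br) -Rintegral_powR// -RintegralZl//.
  apply: le_Rintegral => //; first exact: (Lu_integrableS L_int (ltW a0)).
  move=> u /=; rewrite in_itv/= => /andP[au ub].
  rewrite -powRE ?(lt_le_trans a0)// ler_wpM2r ?powR_ge0// Lmono//.
  exact: le_lt_trans bnu.
have A0 : 0 < a `^ (p + 1) by rewrite powR_gt0.
have AB : a `^ (p + 1) <= b `^ (p + 1).
  by rewrite ge0_ler_powR ?nnegrE ?ltW.
move: Ja Jb A0 AB; set A := a `^ _; set B := b `^ _ => Ja Jb A0 AB.
have h1 : (B - A) * intLu L a <= (B - A) * (M * (A / (p + 1))).
  by rewrite ler_wpM2l// subr_ge0.
have h2 : A * (M * ((B - A) / (p + 1))) <= A * (intLu L b - intLu L a).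
  by rewrite ler_wpM2l// ltW.
have h3 : (B - A) * (M * (A / (p + 1))) = A * (M * ((B - A) / (p + 1))) by ring.
by lra.
Qed.

End PowerScaling.

(** * Riesz representation for a bounded-below operator *)

Section HilbertGeometry.
Variables (R : realType) (s : scalar_kind).

Section OneSpace.
Variable X : hilbertType R s.
Implicit Types (x y z : X) (a : R).

Lemma rinnerNl x z : rinner (- x) z = - rinner x z.
Proof.
by rewrite -scaleN1r_real rinnerZl mulN1r.
Qed.

Lemma rinnerBl x y z : rinner (x - y) z = rinner x z - rinner y z.
Proof. by rewrite rinnerDl rinnerNl. Qed.

Lemma rinnerBr x y z : rinner z (x - y) = rinner z x - rinner z y.
Proof. by rewrite !(rinnerC z) rinnerBl. Qed.

Lemma rnormD_sqr x y :
  rnorm (x + y) ^+ 2 = rnorm x ^+ 2 + 2 * rinner x y + rnorm y ^+ 2.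
Proof. by rewrite -!rinnerxx !(rinnerDl, rinnerDr) (rinnerC y x); ring. Qed.

Lemma rnormB_sqr x y :
  rnorm (x - y) ^+ 2 = rnorm x ^+ 2 - 2 * rinner x y + rnorm y ^+ 2.
Proof. by rewrite -!rinnerxx !(rinnerBl, rinnerBr) (rinnerC y x); ring. Qed.

Lemma rinner0l x : rinner 0 x = 0.
Proof. by have := rinnerBl 0 0 x; rewrite !subrr. Qed.

Lemma rinner0r x : rinner x 0 = 0.
Proof. by rewrite rinnerC rinner0l. Qed.

(** Expand the square of the norm of |y| x - |x| y. *)
Lemma rinner_cauchy_schwarz x y : rinner x y <= rnorm x * rnorm y.
Proof.
have [->|x0] := eqVneq x 0; first by rewrite rinner0l rnorm0 mul0r.
have [->|y0] := eqVneq y 0; first by rewrite rinner0r rnorm0 mulr0.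
have xy0 : 0 < rnorm x * rnorm y by rewrite mulr_gt0// rnorm_gt0.
have := sqr_ge0 (rnorm (scalar_of s (rnorm y) *: x - scalar_of s (rnorm x) *: y)).
rewrite rnormB_sqr !rnormZ rinnerZl rinnerZr !ger0_norm ?rnorm_ge0//.
move: xy0; set p := rnorm x; set q := rnorm y; set r := rinner x y => pq0 h.
have : 0 <= (2 * (p * q)) * (p * q - r) by rewrite (le_trans h)//; lra.
by rewrite pmulr_rge0 1?subr_ge0// mulr_gt0.
Qed.

Lemma rinner_le_norm x y : `|rinner x y| <= rnorm x * rnorm y.
Proof.
rewrite ler_norml rinner_cauchy_schwarz andbT.
by rewrite lerNl -rinnerNl (le_trans (rinner_cauchy_schwarz _ _))// rnormN.
Qed.

End OneSpace.

Section Operators.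
Variables X Y : hilbertType R s.

(** The supremum defining opnorm is meaningful only for a bounded map; real
    homogeneity is all that the reduction to unit vectors uses, so the bound
    covers maps such as the Moore-Penrose inverse before they are known to be
    linear. *)
Lemma opnorm_bound (T : X -> Y) (K : R) :
  (forall a x, T (scalar_of s a *: x) = scalar_of s a *: T x) ->
  (forall x, rnorm (T x) <= K * rnorm x) ->
  forall x, rnorm (T x) <= opnorm T * rnorm x.
Proof.
move=> TZ TK x.
have K_ub y : rnorm y <= 1 -> rnorm (T y) <= `|K|.
  move=> y1; rewrite (le_trans (TK y))// (le_trans (ler_norm _))// normrM.
  by rewrite ler_piMr// ger0_norm// rnorm_ge0.
have [->|x0] := eqVneq x 0.
  by have := TK 0; rewrite rnorm0 !mulr0.
have nx0 : 0 < rnorm x by rewrite rnorm_gt0.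
have nu : rnorm (scalar_of s (rnorm x)^-1 *: x) = 1.
  by rewrite rnormZ gtr0_norm ?invr_gt0// mulVf// gt_eqF.
rewrite -ler_pdivrMr// mulrC -[(rnorm x)^-1]gtr0_norm ?invr_gt0//.
rewrite -rnormZ -TZ; apply: ub_le_sup; last first.
  by exists (scalar_of s (rnorm x)^-1 *: x) => //=; rewrite nu.
by exists `|K| => _ [y /= y1 <-]; exact: K_ub.
Qed.

Lemma opnorm_ge0 (T : X -> Y) : 0 <= opnorm T.
Proof.
rewrite /opnorm; set S := (X in sup X).
have [hS|/sup_out->//] := pselect (has_sup S).
have S0 : S (rnorm (T 0)) by exists 0 => //=; rewrite rnorm0.
apply: le_trans (rnorm_ge0 (T 0)) _.
by apply: ub_le_sup => //; case: hS.
Qed.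

Lemma opnorm_le (T : X -> Y) (K : R) : 0 <= K ->
  (forall x, rnorm (T x) <= K * rnorm x) -> opnorm T <= K.
Proof.
move=> K0 TK; apply: ge_sup; first by exists (rnorm (T 0)), 0 => //=; rewrite rnorm0.
move=> _ [x /= x1 <-]; rewrite (le_trans (TK x))//.
by rewrite ler_piMr.
Qed.

Lemma linearZ_real (A : {linear X -> Y}) a x :
  A (scalar_of s a *: x) = scalar_of s a *: A x.
Proof. exact: linearZ. Qed.

Lemma linear_rnorm_bounded (A : {linear X -> Y}) : continuous A ->
  exists2 K : R, 0 < K & forall x, rnorm (A x) <= K * rnorm x.
Proof.
move=> Ac.
have /cvg_oball/(_ 1 ltr01)/nbhs_oball := Ac 0.
move=> [d d0 hd]; exists (2 / d); first by rewrite divr_gt0.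
move=> x; have [->|x0] := eqVneq x 0.
  by rewrite linear0 !rnorm0 mulr0.
have nx0 : 0 < rnorm x by rewrite rnorm_gt0.
set a := d / (2 * rnorm x).
have a0 : 0 < a by rewrite divr_gt0// mulr_gt0.
have : rnorm (A (scalar_of s a *: x) - A 0) < 1.
  apply: hd; rewrite /oball /= subr0 rnormZ gtr0_norm// /a.
  have -> : d / (2 * rnorm x) * rnorm x = d / 2 by field; rewrite gt_eqF.
  by rewrite ltr_pdivrMr// ltr_pMr// ltr1n.
rewrite linear0 subr0 linearZ_real rnormZ gtr0_norm// => /ltW.
rewrite -ler_pdivlMl// mulr1 => h; rewrite (le_trans h)// /a invf_div.
by rewrite mulrAC.
Qed.

(** Minimise J x = |A x|^2 - 2 f x. A lower bound c |x| <= |A x| makes J bounded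
    below, and by the parallelogram law minimising sequences are Cauchy; the
    vanishing of the first variation at the limit is the claim. Taking A to be
    the identity gives the Riesz theorem, hence adjoints; taking f to be the
    pairing with a vector y gives the least-squares solution of A h = y. *)
Theorem riesz_bounded_below (A : {linear X -> Y}) (f : X -> R) (c C K : R) :
  0 < c -> (forall x, c * rnorm x <= rnorm (A x)) ->
  (forall x, rnorm (A x) <= C * rnorm x) ->
  (forall x y, f (x + y) = f x + f y) ->
  (forall a x, f (scalar_of s a *: x) = a * f x) ->
  (forall x, `|f x| <= K * rnorm x) ->
  exists h, forall x, rinner (A x) (A h) = f x.
Proof.
move=> c0 Ac AC fD fZ fK.
pose J x := rnorm (A x) ^+ 2 - 2 * f x.
have JE t x v : J (x + scalar_of s t *: v) =
    J x + 2 * t * (rinner (A v) (A x) - f v) + t ^+ 2 * rnorm (A v) ^+ 2.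
  rewrite /J linearD linearZ_real rnormD_sqr rinnerZr rnormZ fD fZ exprMn.
  by rewrite (rinnerC (A v)) real_normK ?num_real//; ring.
pose m := inf [set J x | x in setT].
have J_lb : has_lbound [set J x | x in setT].
  exists (- (K / c) ^+ 2) => _ [x _ <-].
  have h1 : (c * rnorm x) ^+ 2 <= rnorm (A x) ^+ 2.
    by rewrite ler_sqr ?nnegrE ?rnorm_ge0// mulr_ge0 ?rnorm_ge0// ltW.
  have h2 : f x <= K * rnorm x by rewrite (le_trans _ (fK x))// ler_norm.
  (* Completing the square in c |x|: J x >= (c |x|)^2 - 2 K |x| >= - (K / c)^2. *)
  have h3 := sqr_ge0 (c * rnorm x - K / c).
  rewrite /J; have E : (c * rnorm x - K / c) ^+ 2 =
    (c * rnorm x) ^+ 2 - 2 * (K * rnorm x) + (K / c) ^+ 2.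
    by field; rewrite gt_eqF.
  rewrite E in h3; lra.
have m_le x : m <= J x by apply: ge_inf => //; exists x.
have approx e : 0 < e -> exists x, J x < m + e.
  move=> e0; have [|_ [x _ <-] hx] := @inf_adherent _ [set J x | x in setT] e e0.
    by split=> //; exists (J 0), 0.
  by exists x.
pose xn n := projT1 (cid (approx n.+1%:R^-1 ltac:(by rewrite invr_gt0))).
have xnP n : J (xn n) < m + n.+1%:R^-1.
  by rewrite /xn; case: cid.
have nearly x e v : J x < m + e ->
    (rinner (A v) (A x) - f v) ^+ 2 <= e * rnorm (A v) ^+ 2.
  move=> Jx; have [Av0|Av0] := eqVneq (rnorm (A v)) 0.
    have v0 : rnorm v = 0.
      apply/eqP; rewrite eq_le rnorm_ge0 andbT -(ler_pM2l c0) mulr0.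
      by rewrite -Av0.
    have fv0 : f v = 0.
      by apply/eqP; rewrite -normr_eq0 eq_le normr_ge0 andbT -(mulr0 K) -v0.
    have -> : A v = 0 by apply/eqP; rewrite -rnorm_eq0 Av0.
    by rewrite rinner0l fv0 rnorm0 subrr !expr0n !mulr0.
  set g := rinner _ _ - _; set q := rnorm (A v) ^+ 2.
  have q0 : 0 < q by rewrite exprn_gt0// lt_def Av0 rnorm_ge0.
  (* The step - g / q minimises J along the line through x in the direction v. *)
  have := m_le (x + scalar_of s (- g / q) *: v); rewrite JE -/g -/q => h.
  have E : 2 * (- g / q) * g + (- g / q) ^+ 2 * q = - (g ^+ 2 / q).
    by field; rewrite gt_eqF.
  by rewrite -ler_pdivrMr//; lra.
have xn_cauchy e : 0 < e -> exists N, forall i j, (N <= i)%N -> (N <= j)%N ->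
    rnorm (xn i - xn j) < e.
  move=> e0; have ce0 : 0 < (c * e) ^+ 2 / 4 by rewrite divr_gt0// exprn_gt0// mulr_gt0.
  have [N hN] : exists N : nat, N.+1%:R^-1 < (c * e) ^+ 2 / 4.
    exists (Num.trunc ((c * e) ^+ 2 / 4)^-1).
    rewrite invf_plt ?posrE//. exact: truncnS_gt.
  exists N => i j Ni Nj.
  (* The midpoint of two almost minimisers has J at least the infimum m. *)
  have parallelogram : rnorm (A (xn i - xn j)) ^+ 2 = 2 * J (xn i) + 2 * J (xn j)
      - 4 * J (xn i + scalar_of s (2^-1) *: (xn j - xn i)).
    rewrite JE linearB (rnormB_sqr (A (xn i))) /J.
    have fN x : f (- x) = - f x.
      by rewrite -scaleN1r_real fZ mulN1r.
    rewrite (linearB A (xn j)) rinnerBl rinnerxx rnormB_sqr fD fN.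
    by rewrite (rinnerC (A (xn j))); field.
  have inv_le k : (N <= k)%N -> k.+1%:R^-1 <= N.+1%:R^-1 :> R.
    by move=> Nk; rewrite lef_pV2 ?posrE// ler_nat.
  have lt1 : rnorm (A (xn i - xn j)) ^+ 2 < (c * e) ^+ 2.
    rewrite parallelogram.
    have := m_le (xn i + scalar_of s (2^-1) *: (xn j - xn i)).
    have := xnP i; have := xnP j; have := inv_le i Ni; have := inv_le j Nj.
    move: hN; move: (N.+1%:R^-1) (i.+1%:R^-1) (j.+1%:R^-1) => rN ri rj.
    move: (J (xn i)) (J (xn j)) (J _) (_ ^+ 2) => *.
    lra.
  rewrite -(ltr_pM2l c0); apply: le_lt_trans (Ac _) _.
  by rewrite -ltr_sqr ?nnegrE ?rnorm_ge0// ?mulr_ge0 ?ltW.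
have [h xh] := rnorm_complete xn_cauchy.
exists h => v; apply/eqP; rewrite -subr_eq0 -normr_eq0 eq_le normr_ge0 andbT.
apply/ler_addgt0Pr => e e0; rewrite add0r.
pose d := e / (2 * (`|C| * rnorm (A v) + 1)).
have d0 : 0 < d by rewrite divr_gt0// mulr_gt0// ltr_wpDl// mulr_ge0// rnorm_ge0.
have /cvg_oball/(_ d d0) ev := xh.
pose q := (e / (2 * (rnorm (A v) + 1))).
have q0 : 0 < q by rewrite divr_gt0// mulr_gt0// ltr_wpDl// rnorm_ge0.
have [N hN] : exists N : nat, N.+1%:R^-1 < q ^+ 2.
  exists (Num.trunc (q ^+ 2)^-1).
  by rewrite invf_plt ?posrE ?exprn_gt0//; exact: truncnS_gt.
have [n Nn hn] : exists2 n, (N <= n)%N & rnorm (xn n - h) < d.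
  have [n [? ?]] := @filter_ex _ \oo _ _ (filterI (nbhs_infty_ge N) ev).
  by exists n.
have -> : rinner (A v) (A h) - f v =
    (rinner (A v) (A (xn n)) - f v) - rinner (A v) (A (xn n - h)).
  by rewrite linearB rinnerBr; ring.
rewrite (le_trans (ler_normB _ _))// [e]splitr lerD//.
  have := nearly _ _ v (xnP n); set g := _ - _ => g2.
  have qe : q * rnorm (A v) <= e / 2.
    rewrite /q invfM mulrA -mulrA ler_piMr ?divr_ge0 ?ltW//.
    by rewrite mulrC ltr_pdivrMr ?ltr_wpDl ?rnorm_ge0// mul1r ltrDl.
  apply: le_trans qe.
  have qA0 : 0 <= q * rnorm (A v) by rewrite mulr_ge0 ?rnorm_ge0// ltW.
  rewrite -ler_sqr ?nnegrE//.
  rewrite real_normK ?num_real// (le_trans g2)// exprMn ler_wpM2r ?sqr_ge0//.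
  by rewrite (le_trans _ (ltW hN))// lef_pV2 ?posrE// ler_nat.
rewrite (le_trans (rinner_le_norm _ _))//.
have h1 : rnorm (A (xn n - h)) <= `|C| * d.
  rewrite (le_trans (AC _))// (le_trans (ler_wpM2r (rnorm_ge0 _) (ler_norm C)))//.
  by rewrite ler_wpM2l// ltW.
rewrite (le_trans (ler_wpM2l (rnorm_ge0 _) h1))//.
rewrite /d; set w := `|C| * rnorm (A v).
have w0 : 0 <= w by rewrite mulr_ge0// rnorm_ge0.
have -> : rnorm (A v) * (`|C| * (e / (2 * (w + 1)))) = e / 2 * (w / (w + 1)).
  by rewrite /w; field; rewrite -/w gt_eqF// ltr_wpDl.
rewrite ler_piMr//; first by rewrite divr_ge0// ltW.
by rewrite ler_pdivrMr ?ltr_wpDl// mul1r lerDl.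
Qed.

End Operators.
End HilbertGeometry.

(** * The Moore-Penrose inverse as least-squares solution *)

Section MoorePenrose.
Variables (R : realType) (s : scalar_kind).

(** In a complex space the imaginary part of the pairing with x is, up to sign,
    the real part of the pairing with i x. *)
Lemma inner_rinner (X Y : hilbertType R s) (A : {linear X -> Y}) (y : Y) (z : X) :
  (forall x, rinner (A x) y = rinner x z) ->
  forall x, inner Y (A x) y = inner X x z.
Proof.
rewrite /rinner; case: s X Y A y z => //= X' Y' A y z h x.
have := h ('i%C *: x); rewrite linearZ_LR !linearZl_LR /=.
have := h x; case: (inner Y' (A x) y) => a b; case: (inner X' x z) => c d /= -> .
by rewrite !mul0r !mul1r !sub0r => /oppr_inj ->.
Qed.

Lemma rinner_inj (X : hilbertType R s) (y z : X) :
  (forall x, rinner x y = rinner x z) -> y = z.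
Proof.
move=> /(_ (y - z)) /eqP; rewrite -subr_eq0 -rinnerBr rinnerxx sqrf_eq0.
by rewrite rnorm_eq0 subr_eq0 => /eqP.
Qed.

Variables X Y : hilbertType R s.
Variables (A : {linear X -> Y}) (c C : R).
Hypothesis c0 : 0 < c.
Hypothesis Ac : forall x, c * rnorm x <= rnorm (A x).
Hypothesis AC : forall x, rnorm (A x) <= C * rnorm x.

(** The adjoint is defined by choice; a bounded A has one because pairing
    A x with y is a bounded functional of x. *)
Lemma rinner_adjoint x y : rinner (A x) y = rinner x (adjoint A y).
Proof.
suff [z hz] : exists z, forall x, inner Y (A x) y = inner X x z.
  rewrite /rinner.
  by rewrite (@xgetPex _ 0 [set z | forall x, inner Y (A x) y = inner X x z]
    (ex_intro _ z hz) x).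
have [||||||z hz] := @riesz_bounded_below R s X X idfun
  (fun x => rinner (A x) y) 1 1 (`|C| * rnorm y).
- exact: ltr01.
- by move=> u; rewrite mul1r.
- by move=> u; rewrite mul1r.
- by move=> u v; rewrite linearD rinnerDl.
- by move=> a u; rewrite linearZ_real rinnerZl.
- move=> u; rewrite (le_trans (rinner_le_norm _ _))// mulrAC ler_wpM2r ?rnorm_ge0//.
  by rewrite (le_trans (AC _))// ler_wpM2r ?rnorm_ge0// ler_norm.
by exists z; apply: inner_rinner => u; rewrite -hz.
Qed.

(** The normal equations: A applied to the Moore-Penrose solution is the
    orthogonal projection of y onto the range of A. *)
Lemma rinner_moore_penrose x y :
  rinner (A x) (A (moore_penrose A y)) = rinner (A x) y.
Proof.
rewrite !rinner_adjoint; congr rinner.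
have [||||||h hh] := @riesz_bounded_below R s X Y A
  (fun x => rinner (A x) y) c C (`|C| * rnorm y).
- exact: c0.
- exact: Ac.
- exact: AC.
- by move=> u v; rewrite linearD rinnerDl.
- by move=> a u; rewrite linearZ_real rinnerZl.
- move=> u; rewrite (le_trans (rinner_le_norm _ _))// mulrAC ler_wpM2r ?rnorm_ge0//.
  by rewrite (le_trans (AC _))// ler_wpM2r ?rnorm_ge0// ler_norm.
apply: (@xgetPex _ 0 [set v | (adjoint A \o A) v = adjoint A y]); exists h => /=.
by apply: rinner_inj => u; rewrite -!rinner_adjoint.
Qed.

Lemma moore_penrose_unique y h :
  (forall x, rinner (A x) (A h) = rinner (A x) y) -> moore_penrose A y = h.
Proof.
move=> hh; apply/eqP; rewrite -subr_eq0 -rnorm_eq0 eq_le rnorm_ge0 andbT.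
rewrite -(ler_pM2l c0) mulr0 (le_trans (Ac _))//.
suff /eqP -> : rnorm (A (moore_penrose A y - h)) == 0 by [].
by rewrite -sqrf_eq0 -rinnerxx {2}linearB rinnerBr rinner_moore_penrose hh subrr.
Qed.

Lemma moore_penrose_scale a y :
  moore_penrose A (scalar_of s a *: y) = scalar_of s a *: moore_penrose A y.
Proof.
apply: moore_penrose_unique => x.
by rewrite linearZ_real !rinnerZr rinner_moore_penrose.
Qed.

(** The normal equations make A (v - h), for h the Moore-Penrose solution for y,
    the projection of A v - y onto the range of A. For v = 0 the inequality
    bounds the norm of the Moore-Penrose inverse by 1 / c. *)
Lemma moore_penrose_dist v y : c * rnorm (v - moore_penrose A y) <= rnorm (A v - y).
Proof.
set w := v - _; apply: le_trans (Ac _) _.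
have [->|w0] := eqVneq (rnorm (A w)) 0; first exact: rnorm_ge0.
have Aw0 : 0 < rnorm (A w) by rewrite lt_def w0 rnorm_ge0.
rewrite -(ler_pM2l Aw0) -expr2 -rinnerxx.
have Ew : A w = A v - A (moore_penrose A y) by exact: linearB.
by rewrite {2}Ew rinnerBr rinner_moore_penrose -rinnerBr rinner_cauchy_schwarz.
Qed.

Lemma moore_penroseK v : moore_penrose A (A v) = v.
Proof. exact: moore_penrose_unique. Qed.

Lemma rnorm_moore_penrose y : rnorm (moore_penrose A y) <= c^-1 * rnorm y.
Proof.
have := moore_penrose_dist 0 y; rewrite linear0 !sub0r !rnormN => h.
by rewrite ler_pdivlMl.
Qed.

(** Together with the bound by 1 / c: the norm of the Moore-Penrose inverse is
    the reciprocal of the best lower bound for A. *)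
Lemma le_opnorm_moore_penrose x :
  rnorm x <= opnorm (moore_penrose A) * rnorm (A x).
Proof.
rewrite -{1}(moore_penroseK x).
exact: (opnorm_bound moore_penrose_scale rnorm_moore_penrose).
Qed.

End MoorePenrose.

(** * Bounded inverse theorem *)

Section HalvingSequences.
Variables (R : realType) (s : scalar_kind) (X : hilbertType R s).
Variables (r : nat -> R) (u : nat -> X).
Hypothesis r_ge0 : forall n, 0 <= r n.
Hypothesis r_half : forall n, r n.+1 <= r n / 2.
Hypothesis u_step : forall n, rnorm (u n.+1 - u n) <= r n / 2.

Lemma halving_dist n k : rnorm (u (n + k)%N - u n) <= r n.
Proof.
suff : rnorm (u (n + k)%N - u n) <= r n - r (n + k)%N.
  by move=> h; rewrite (le_trans h)// gerBl.
elim: k => [|k IH]; first by rewrite addn0 !subrr rnorm0.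
rewrite addnS (le_trans (ler_rdistD (u (n + k)%N) _ _))//.
by have := u_step (n + k); have := r_half (n + k); lra.
Qed.

Lemma halving_small (e : R) : 0 < e -> exists n, r n < e.
Proof.
move=> e0; pose n := (Num.trunc (r 0 / e)).+1; exists n.
have rn k : r k * 2 ^+ k <= r 0.
  elim: k => [|k IH]; first by rewrite expr0 mulr1.
  apply: le_trans IH; rewrite exprS mulrA ler_wpM2r ?exprn_ge0//.
  by rewrite -ler_pdivlMr.
have n2 : n%:R < 2 ^+ n :> R by rewrite -natrX ltr_nat ltn_expl.
have : r 0 / e < n%:R by rewrite truncnS_gt.
rewrite ltr_pdivrMr// => h.
have : r n * 2 ^+ n < e * 2 ^+ n.
  by rewrite (le_lt_trans (rn n))// (lt_trans h)// mulrC ltr_pM2l.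
by rewrite ltr_pM2r// exprn_gt0.
Qed.

Lemma halving_cauchy (e : R) : 0 < e -> exists N, forall m n,
  (N <= m)%N -> (N <= n)%N -> rnorm (u m - u n) < e.
Proof.
move=> e0; have [N hN] := halving_small (divr_gt0 e0 (ltr0n R 2)).
exists N => m n /subnKC <- /subnKC <-.
rewrite (le_lt_trans (ler_rdistD (u N) _ _))// [e]splitr [_ (u N - _)]rdistC.
by apply: ltrD; apply: le_lt_trans (halving_dist _ _) hN.
Qed.

Lemma halving_lim l : u @ \oo --> l -> forall n, rnorm (l - u n) <= r n.
Proof.
move=> /cvg_oball ul n; apply/ler_addgt0Pr => e e0.
have [k [/= nk hk]] := @filter_ex _ \oo _ _ (filterI (nbhs_infty_ge n) (ul e e0)).
rewrite (le_trans (ler_rdistD (u k) _ _))// addrC rdistC lerD//; last first.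
  by rewrite rdistC ltW.
by rewrite -(subnKC nk) rdistC halving_dist.
Qed.

End HalvingSequences.

Section BoundedInverse.
Variables (R : realType) (s : scalar_kind) (X Y : hilbertType R s).
Variable A : {linear X -> Y}.
Hypothesis A_cont : continuous A.
Hypothesis A_inj : injective A.
Hypothesis A_closed : closed (range A).

(** The points whose image lies in the closure of the image of the ball of
    radius r. Since A is injective with closed range, the norm |A x| makes X
    complete, and Baire's argument can be run inside X with this norm. *)
Definition nearly_image (r : R) : set X :=
  [set x | forall e : R, 0 < e -> exists2 u, rnorm u <= r & rnorm (A x - A u) < e].

Lemma closed_range_lim (u : nat -> X) :
  (forall e : R, 0 < e -> exists N, forall m n, (N <= m)%N -> (N <= n)%N ->
     rnorm (A (u m) - A (u n)) < e) ->
  exists x, (A \o u) @ \oo --> A x.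
Proof.
move=> hu; have [y uy] := @rnorm_complete R s Y (A \o u) hu.
suff [x _ xy] : range A y by exists x; rewrite xy.
apply: (closed_cvg _ A_closed _ _ uy) => //.
by apply: nearW => n; exists (u n).
Qed.

(** Baire's theorem for the norm |A x|: the sets nearly_image n cover X, and if
    none of them contained a ball one could choose shrinking balls, the n-th
    avoiding the image of the ball of radius n, whose common point would lie
    outside all of these images. *)
Lemma nearly_image_ball : exists n a (r : R), 0 < r /\
  forall x, rnorm (A x - A a) < r -> nearly_image n%:R x.
Proof.
apply: contrapT => no_ball.
have step n (ar : X * R) : exists br : X * R, 0 < ar.2 ->
    [/\ 0 < br.2, br.2 <= ar.2 / 2, rnorm (A br.1 - A ar.1) <= ar.2 / 2 &
     forall u, rnorm u <= n%:R -> 2 * br.2 <= rnorm (A br.1 - A u)].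
  have [r0|] := ltP 0 ar.2; last by exists ar.
  apply: contrapT => no_step; apply: no_ball.
  exists n, ar.1, (ar.2 / 2); split; first by rewrite divr_gt0.
  move=> x xr e e0; apply: contrapT => no_u; apply: no_step.
  (* A x stays at distance at least e from the image of the n-ball, and the limit
     will be within e / 2 of A x. *)
  exists (x, Num.min e ar.2 / 2) => _; split => /=.
  - by rewrite divr_gt0// lt_min e0.
  - by rewrite ler_pM2r// ge_min lexx orbT.
  - exact: ltW.
  - move=> u un; rewrite mulrCA divff// mulr1 ge_min; apply/orP; left.
    by rewrite leNgt; apply/negP => ue; apply: no_u; exists u.
pose nxt n ar := projT1 (cid (step n ar)).
pose st := fix st n : X * R := if n is m.+1 then nxt m (st m) else (0, 1).
have stP n : 0 < (st n).2 -> _ := projT2 (cid (step n (st n))).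
have r_gt0 n : 0 < (st n).2 by elim: n => [|n /stP[]].
pose r n := (st n).2; pose u n := A (st n).1.
have r_half n : r n.+1 <= r n / 2 by have [] := stP n (r_gt0 n).
have u_step n : rnorm (u n.+1 - u n) <= r n / 2 by have [] := stP n (r_gt0 n).
have [x xu] := closed_range_lim (halving_cauchy (fun n => ltW (r_gt0 n)) r_half u_step).
have := halving_lim (fun n => ltW (r_gt0 n)) r_half u_step xu.
(* The limit x has norm at most n, yet the (n+1)-st ball was chosen to avoid A x. *)
pose n := (Num.trunc (rnorm x)).+1.
move=> /(_ n.+1); have [_ _ _ /(_ x)] := stP n (r_gt0 n).
have xn : rnorm x <= n%:R by rewrite ltW// truncnS_gt.
move=> /(_ xn) h1; rewrite rdistC => /(le_trans h1).
have := r_gt0 n.+1; rewrite /r -/(st n.+1); lra.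
Qed.

(** A difference of two points of the ball above is near the image of the ball
    of radius 2 n; scaling moves the centre to the origin at every scale. *)
Lemma nearly_image_scale : exists N r : R, [/\ 0 <= N, 0 < r &
  forall t x, 0 < t -> rnorm (A x) < r * t -> nearly_image (N * t) x].
Proof.
have [n [a [r [r0 hr]]]] := nearly_image_ball.
exists (2 * n%:R), r; split => //.
move=> t x t0 xt e e0.
have et0 : 0 < e / t / 2 by rewrite !divr_gt0.
have ax : rnorm (A (a + scalar_of s t^-1 *: x) - A a) < r.
  rewrite linearD addrAC subrr add0r linearZ_real rnormZ gtr0_norm ?invr_gt0//.
  by rewrite mulrC ltr_pdivrMr.
have [u un hu] := hr _ ax _ et0.
have aa : rnorm (A a - A a) < r by rewrite subrr rnorm0.
have [v vn hv] := hr _ aa _ et0.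
exists (scalar_of s t *: (u - v)).
  rewrite rnormZ gtr0_norm// mulrC ler_pM2r// (le_trans (ler_rnormD _ _))//.
  by rewrite rnormN mulr_natl mulr2n lerD.
have -> : A x - A (scalar_of s t *: (u - v)) =
    scalar_of s t *: ((A (a + scalar_of s t^-1 *: x) - A u) - (A a - A v)).
  have regroup (p q r' w : Y) : (p + w - q) - (p - r') = w - (q - r').
    by rewrite !opprB -[p + w - q]addrA [LHS]addrC [LHS]addrA subrK addrCA.
  rewrite linearZ_real linearD linearB linearZ_real regroup.
  move: (A u - A v) => z; rewrite scalerBr scalerA.
  by rewrite -scalar_ofM divff ?gt_eqF// scalar_of1 scale1r.
rewrite rnormZ gtr0_norm// -ltr_pdivlMl// (le_lt_trans (ler_rnormD _ _))//.
by rewrite rnormN mulrC [ltRHS]splitr ltrD.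
Qed.

(** The usual iteration of the open mapping theorem: correct the remaining error
    at each scale by an element half as large. The corrections sum to a
    preimage, which injectivity identifies with the given point. *)
Theorem closed_range_bounded_below :
  exists2 c : R, 0 < c & forall x, c * rnorm x <= rnorm (A x).
Proof.
have [K K0 AK] := linear_rnorm_bounded A_cont.
have [N [r [N0 r0 hN]]] := nearly_image_scale.
suff ball_bound x : rnorm (A x) < r -> rnorm x <= 2 * N.
  pose M := 2 * N + 1; have M0 : 0 < M by rewrite /M; lra.
  exists (r / (2 * M)); first by rewrite divr_gt0// mulr_gt0.
  move=> x; have [Ax0|Ax0] := eqVneq (A x) 0.
    have -> : x = 0 by apply: A_inj; rewrite linear0.
    by rewrite linear0 !rnorm0 mulr0.
  have q0 : 0 < rnorm (A x) by rewrite rnorm_gt0.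
  set q := rnorm (A x) in q0 *.
  have t0 : 0 < r / (2 * q) by rewrite divr_gt0// mulr_gt0.
  have := ball_bound (scalar_of s (r / (2 * q)) *: x).
  rewrite linearZ_real !rnormZ gtr0_norm// -/q.
  have -> : r / (2 * q) * q = r / 2 by field; rewrite gt_eqF.
  rewrite ltr_pdivrMr// ltr_pMr// ltr1n => /(_ isT) h.
  have {}h : r / (2 * q) * rnorm x <= M by rewrite (le_trans h)// /M; lra.
  have -> : r / (2 * M) * rnorm x = q / M * (r / (2 * q) * rnorm x).
    by field; rewrite !gt_eqF.
  rewrite (le_trans (ler_wpM2l _ h))//; first by rewrite divr_ge0// ltW.
  by rewrite divfK// gt_eqF.
move=> xr; pose d k : R := 2^-1 ^+ k.
have d0 k : 0 < d k by rewrite exprn_gt0.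
have dS k : d k.+1 = d k / 2 by rewrite /d exprSr.
have step k (y : X) : exists u, rnorm (A (x - y)) < r * d k ->
    rnorm u <= N * d k /\ rnorm (A (x - y) - A u) < r * d k.+1.
  have [hy|] := ltP (rnorm (A (x - y))) (r * d k); last by exists 0.
  have rd0 : 0 < r * d k.+1 by rewrite mulr_gt0.
  have [u uN hu] := hN (d k) (x - y) (d0 k) hy _ rd0.
  by exists u.
pose incr k y := projT1 (cid (step k y)).
pose y := fix y n : X := if n is m.+1 then y m + incr m (y m) else 0.
have incrP k : rnorm (A (x - y k)) < r * d k -> _ := projT2 (cid (step k (y k))).
have y_near k : rnorm (A (x - y k)) < r * d k.
  elim: k => [|k IH]; first by rewrite /= subr0 /d expr0 mulr1.
  by have [_] := incrP k IH; rewrite -linearB opprD addrA.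
pose rad k := 2 * N * d k.
have rad0 k : 0 <= rad k by rewrite !mulr_ge0// ltW.
have rad_half k : rad k.+1 <= rad k / 2 by rewrite /rad dS mulrA.
have y_step k : rnorm (y k.+1 - y k) <= rad k / 2.
  have -> : rad k / 2 = N * d k by rewrite /rad; field.
  rewrite /= addrAC subrr add0r.
  by have [] := incrP k (y_near k).
have [z yz] := rnorm_complete (halving_cauchy rad0 rad_half y_step).
have := halving_lim rad0 rad_half y_step yz 0; rewrite /= subr0 /rad /d expr0 mulr1.
suff -> : x = z by [].
apply: A_inj; apply/eqP; rewrite -subr_eq0 -rnorm_eq0 eq_le rnorm_ge0 andbT.
apply/ler_addgt0Pr => e e0; rewrite add0r.
(* Both |A (x - y k)| and |A (z - y k)| are bounded by multiples of 2^-k. *)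
pose err k := (r + K * (2 * N)) * d k.
have err_half k : err k.+1 <= err k / 2 by rewrite /err dS mulrA.
have [k err_e] := halving_small err_half e0.
have -> : A x - A z = A (x - y k) - A (z - y k).
  by rewrite -!linearB; congr (A _); rewrite opprB addrA subrK.
rewrite (le_trans (ler_rnormD _ _))// rnormN (le_trans _ (ltW err_e))//.
rewrite /err mulrDl lerD//; first exact/ltW.
rewrite -mulrA (le_trans (AK _))// ler_pM2l//.
exact: (halving_lim rad0 rad_half y_step yz k).
Qed.

End BoundedInverse.

(** * Mean value inequalities *)

Section MeanValue.
Variables (R : realType) (s : scalar_kind).

(** Continuous induction: the t for which
    |f t - f 0| <= G t - G 0 + e t form a set that contains its supremum and
    extends to the right of each of its points below 1, so it contains 1. Only
    increments of G are compared, so G need not be given as the integral of a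
    derivative. *)
Lemma increment_bound (Y : hilbertType R s) (f : R -> Y) (G : R -> R) :
  (forall u v, 0 <= u -> u <= v -> v <= 1 -> G u <= G v) ->
  (forall t e, 0 <= t <= 1 -> 0 < e -> exists2 d, 0 < d &
    forall u, 0 <= u <= 1 -> `|u - t| < d ->
      rnorm (f u - f t) <= `|G u - G t| + e * `|u - t|) ->
  rnorm (f 1 - f 0) <= G 1 - G 0.
Proof.
move=> Gmono loc; apply/ler_addgt0Pr => e e0.
pose good t := rnorm (f t - f 0) <= G t - G 0 + e * t.
pose S := [set t | 0 <= t <= 1 /\ good t].
have S0 : S 0 by split; rewrite ?lexx ?ler01// /good !subrr rnorm0 mulr0 addr0.
have hS : has_sup S by split; [exists 0|exists 1 => t [/andP[]]].
pose c := sup S.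
have c0 : 0 <= c by apply: ub_le_sup => //; case: hS.
have c1 : c <= 1 by apply: ge_sup; [exists 0|move=> t [/andP[]]].
have c01 : 0 <= c <= 1 by rewrite c0 c1.
have step a b : 0 <= a -> a <= b -> b <= 1 -> good a ->
    rnorm (f b - f a) <= `|G b - G a| + e * `|b - a| -> good b.
  move=> a0 ab b1 ga; have Gab := Gmono _ _ a0 ab b1.
  rewrite !ger0_norm ?subr_ge0// => hb; rewrite /good.
  by rewrite (le_trans (ler_rdistD (f a) _ _))//; rewrite /good in ga; lra.
have [d d0 hd] := loc c e c01 e0.
have gc : good c.
  have [t [/andP[t0 t1] gt] ct] := sup_adherent d0 hS.
  rewrite -/c in ct.
  have tc : t <= c by apply: ub_le_sup; [case: hS|split; rewrite ?t0].
  apply: (step t) => //.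
  rewrite rdistC (distrC (G _)) (distrC c); apply: hd; first by rewrite t0.
  by rewrite distrC ger0_norm ?subr_ge0//; lra.
have [c_lt1|c_ge1] := ltP c 1; last first.
  have <- : c = 1 by apply/eqP; rewrite eq_le c1.
  by move: gc; rewrite /good => /le_trans; apply; rewrite lerD2l ler_piMr// ltW.
pose u := Num.min 1 (c + d / 2).
have cu : c < u by rewrite lt_min c_lt1 ltrDl divr_gt0.
have u1 : u <= 1 by rewrite ge_min lexx.
have ucd : u <= c + d / 2 by rewrite ge_min lexx orbT.
have gu : good u.
  apply: (step c) => //; first exact: ltW.
  apply: hd; first by rewrite u1 (le_trans c0 (ltW cu)).
  by rewrite gtr0_norm ?subr_gt0//; lra.
have : u <= c.
  apply: ub_le_sup; first by case: hS.
  by split=> //; rewrite u1 (le_trans c0 (ltW cu)).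
by rewrite leNgt cu.
Qed.

Variables X Y : hilbertType R s.

(** Over complex scalars norms take complex values; the expansion in the real
    norm is what the real curve t |-> F (x + t v) needs. *)
Lemma differentiable_rnorm (F : X -> Y) (x : X) (e : R) : differentiable F x -> 0 < e ->
  exists2 d, 0 < d & forall h, rnorm h < d ->
    rnorm (F (x + h) - F x - 'd F x h) <= e * rnorm h.
Proof.
move=> dF e0.
have e0' : 0 < scalar_of s e by rewrite -(scalar_of0 R s) ltr_scalar_of.
have /eqaddoP/(_ _ e0') := diff_locally dF.
move=> /nbhs_oball[d d0 hd]; exists d => // h hh.
have := hd h; rewrite /oball /= subr0 => /(_ hh).
rewrite !normE -scalar_ofM ler_scalar_of.
rewrite -[(_ - _) h]/(F (h + x) - (F x + 'd F x h)) opprD addrA [h + x]addrC.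
by [].
Qed.

Lemma mean_value_rnorm (F : X -> Y) (B : {linear X -> Y}) (x v : X) (g G : R -> R) :
  continuous B ->
  (forall t, 0 <= t <= 1 -> differentiable F (x + scalar_of s t *: v)) ->
  (forall t, 0 <= t <= 1 ->
    rnorm ('d F (x + scalar_of s t *: v) v - B v) <= g t) ->
  (forall u w, 0 <= u -> u <= w -> w <= 1 -> G u <= G w) ->
  (forall t e, 0 <= t <= 1 -> 0 < e -> exists2 d, 0 < d &
    forall u, 0 <= u <= 1 -> `|u - t| < d ->
      g t * `|u - t| <= `|G u - G t| + e * `|u - t|) ->
  rnorm (F (x + v) - F x - B v) <= G 1 - G 0.
Proof.
move=> Bc dF dFB Gmono loc.
pose f t := F (x + scalar_of s t *: v) - scalar_of s t *: B v.
have -> : F (x + v) - F x - B v = f 1 - f 0.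
  by rewrite /f scalar_of1 scalar_of0 !scale1r !scale0r addr0 subr0 addrAC.
apply: increment_bound => // t e t01 e0.
have e20 : 0 < e / 2 by rewrite divr_gt0.
have [d1 d10 hd1] := loc t (e / 2) t01 e20.
have nv0 : 0 < rnorm v + 1 by rewrite ltr_wpDl// rnorm_ge0.
have e30 : 0 < e / 2 / (rnorm v + 1) by rewrite divr_gt0.
have [d2 d20 hd2] := differentiable_rnorm (dF t t01) e30.
exists (Num.min d1 (d2 / (rnorm v + 1))); first by rewrite lt_min d10 divr_gt0.
move=> u u01; rewrite lt_min => /andP[ud1 ud2].
set a := u - t in ud1 ud2 *.
set y := x + scalar_of s t *: v.
have uE : u = t + a by rewrite /a addrC subrK.
have -> : f u - f t = (F (y + scalar_of s a *: v) - F y - 'd F y (scalar_of s a *: v))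
    + scalar_of s a *: ('d F y v - B v).
  rewrite /f -/y uE scalar_ofD scalerDl addrA -/y scalerDl.
  rewrite scalerBr.
  have regroup (p q c d w : Y) : p - (c + d) - (q - c) = p - q - w + (w - d).
    rewrite [RHS]addrA subrK opprD opprB -!addrA; congr (p + _).
    by rewrite addrCA addKr addrC.
  have dZ : 'd F y (scalar_of s a *: v) = scalar_of s a *: 'd F y v.
    exact: linearZ_real.
  by rewrite -dZ; exact: regroup.
rewrite (le_trans (ler_rnormD _ _))// rnormZ.
have h1 := hd1 u u01 ud1.
have an : rnorm (scalar_of s a *: v) = `|a| * rnorm v by rewrite rnormZ.
have avd : rnorm (scalar_of s a *: v) < d2.
  rewrite an; move: ud2; rewrite ltr_pdivlMr// => /le_lt_trans; apply.
  by rewrite ler_wpM2l// lerDl.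
have h2 := hd2 _ avd.
have h3 : `|a| * rnorm ('d F y v - B v) <= g t * `|a|.
  by rewrite mulrC ler_wpM2r// dFB.
have h4 : e / 2 / (rnorm v + 1) * rnorm (scalar_of s a *: v) <= e / 2 * `|a|.
  rewrite an; have -> : e / 2 / (rnorm v + 1) * (`|a| * rnorm v) =
      e / 2 * `|a| * (rnorm v / (rnorm v + 1)) by field; rewrite gt_eqF.
  rewrite ler_piMr//; first by rewrite mulr_ge0// ltW.
  by rewrite ler_pdivrMr// mul1r lerDl.
have := lerD (le_trans h2 h4) (le_trans h3 h1); rewrite -/a => /le_trans; apply.
rewrite -/a; lra.
Qed.

End MeanValue.

Section RadialMeanValue.
Variables (R : realType) (s : scalar_kind) (X Y : hilbertType R s).

(** The derivative bound h is only assumed continuous, and the primitive H enters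
    through (b - a) min (h a, h b) <= H b - H a. For the bounds of this file h is
    monotone in either direction, and this covers both cases. *)
Lemma mean_value_radial (F : X -> Y) (B : {linear X -> Y}) (x v : X)
    (beta : R) (h H : R -> R) :
  0 < beta -> continuous B ->
  (forall t, 0 <= t <= 1 -> differentiable F (x + scalar_of s t *: v)) ->
  (forall t, 0 <= t <= 1 ->
    beta * rnorm ('d F (x + scalar_of s t *: v) v - B v)
      <= h (t * rnorm v) * rnorm v) ->
  (forall a, 0 <= a <= rnorm v -> 0 <= h a) ->
  (forall a e, 0 <= a <= rnorm v -> 0 < e -> exists2 d, 0 < d &
    forall b, 0 <= b <= rnorm v -> `|b - a| < d -> `|h b - h a| < e) ->
  (forall a b, 0 <= a -> a <= b -> b <= rnorm v ->
    (b - a) * Num.min (h a) (h b) <= H b - H a) ->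
  beta * rnorm (F (x + v) - F x - B v) <= H (rnorm v) - H 0.
Proof.
set r := rnorm v => beta0 Bc dF dFB h0 hc Hh.
have r0 : 0 <= r by exact: rnorm_ge0.
have scale_itv t : 0 <= t <= 1 -> 0 <= t * r <= r.
  by move=> /andP[t0 t1]; rewrite mulr_ge0//= ler_piMl.
have Hmono a b : 0 <= a -> a <= b -> b <= r -> H a <= H b.
  move=> a0 ab br; rewrite -subr_ge0 (le_trans _ (Hh _ _ a0 ab br))//.
  have ha : 0 <= h a by apply: h0; rewrite a0 (le_trans ab).
  have hb : 0 <= h b by apply: h0; rewrite (le_trans a0 ab).
  by rewrite mulr_ge0 ?subr_ge0// le_min ha.
pose G t := H (t * r) / beta.
pose g t := h (t * r) * r / beta.
suff : rnorm (F (x + v) - F x - B v) <= G 1 - G 0.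
  by rewrite /G mul1r mul0r -mulrBl ler_pdivlMr// mulrC.
apply: (@mean_value_rnorm _ _ _ _ F B x v g G) => //.
- by move=> t t01; rewrite /g ler_pdivlMr// mulrC dFB.
- move=> u w u0 uw w1; rewrite /G ler_pM2r ?invr_gt0//; apply: Hmono.
  + by rewrite mulr_ge0.
  + by rewrite ler_wpM2r.
  + by rewrite ler_piMl.
move=> t e t01 e0.
have e'0 : 0 < e * beta / (r + 1) by rewrite divr_gt0 ?mulr_gt0// ltr_wpDl.
have [d d0 hd] := hc _ _ (scale_itv _ t01) e'0.
exists (d / (r + 1)); first by rewrite divr_gt0// ltr_wpDl.
move=> u u01 ut.
have near_tu : `|u * r - t * r| < d.
  rewrite -mulrBl normrM (ger0_norm r0); move: ut.
  rewrite ltr_pdivlMr ?ltr_wpDl// => /le_lt_trans; apply.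
  by rewrite ler_wpM2l// lerDl.
have hut := hd _ (scale_itv _ u01) near_tu.
have GE : `|G u - G t| = `|H (u * r) - H (t * r)| / beta.
  by rewrite /G -mulrBl normrM (gtr0_norm (x := beta^-1)) ?invr_gt0.
have [/andP[t0 t1] /andP[u0 u1]] := (t01, u01).
have dH : `|u - t| * r * Num.min (h (t * r)) (h (u * r)) <= `|H (u * r) - H (t * r)|.
  have [tu|ut'] := leP t u.
    rewrite ger0_norm ?subr_ge0// mulrBl (le_trans _ (ler_norm _))// Hh//.
    - by rewrite mulr_ge0.
    - by rewrite ler_wpM2r.
    - by rewrite ler_piMl.
  rewrite distrC (distrC (H _)) gtr0_norm ?subr_gt0// mulrBl minC.
  rewrite (le_trans _ (ler_norm _))// Hh//.
  - by rewrite mulr_ge0.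
  - by rewrite ler_wpM2r// ltW.
  - by rewrite ler_piMl.
have minP : h (t * r) - e * beta / (r + 1) <= Num.min (h (t * r)) (h (u * r)).
  rewrite le_min; move: hut e'0; rewrite ltr_norml => /andP[].
  by move: (e * _ / _) => e'; lra.
have rw0 : 0 <= `|u - t| * r by rewrite mulr_ge0.
have h1 : `|u - t| * r * (h (t * r) - e * beta / (r + 1)) <=
    `|H (u * r) - H (t * r)| by rewrite (le_trans _ dH)// ler_wpM2l.
have h2 : `|u - t| * r * (e * beta / (r + 1)) <= e * beta * `|u - t|.
  have -> : `|u - t| * r * (e * beta / (r + 1)) =
      e * beta * `|u - t| * (r / (r + 1)) by field; rewrite gt_eqF// ltr_wpDl.
  rewrite ler_piMr//; first by rewrite !mulr_ge0// ltW.
  by rewrite ler_pdivrMr ?ltr_wpDl// mul1r lerDl.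
rewrite GE /g; have -> : h (t * r) * r / beta * `|u - t| =
  `|u - t| * r * h (t * r) / beta by field; rewrite gt_eqF.
rewrite -[e * _](mulfK (lt0r_neq0 beta0)) -mulrDl ler_pM2r ?invr_gt0//.
by move: h1 h2; rewrite mulrBr [e * beta * _]mulrAC; lra.
Qed.

End RadialMeanValue.

(** * The scalar majorant sequence *)

Section MajorantSequence.
Variables (R : realType) (L : R -> R) (rad : R).
Local Notation mu := (@lebesgue_measure R).
Hypothesis rad_pos : 0 < rad.
Hypothesis L_pos : forall u, 0 <= u < rad -> 0 < L u.
Hypothesis L_int : mu.-integrable `[0, rad[ (EFin \o L).

Local Notation I0 := (intL L 0).
Local Notation J := (intLu L).

(** The constants of the theorem are suprema, and the supremum of the empty set
    is 0, so a point below one of them certifies that the set is inhabited. *)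
Lemma sup_gt_pos (S : set R) x : 0 <= x -> x < sup S -> exists2 y, S y & x < y.
Proof.
move=> x0 xS; apply: (sup_gt _ xS); apply/set0P; apply: contraTneq xS => ->.
by rewrite sup0 ltNge x0.
Qed.

Lemma intL0_small e : 0 < e ->
  exists2 d, 0 < d < rad & forall u, 0 <= u -> u <= d -> 0 <= I0 u < e.
Proof.
move=> e0; have [d d0 hd] := intL_continuous L_int (lexx 0) rad_pos e0.
have r2 : rad / 2 < rad by have := rad_pos; lra.
exists (Num.min (d / 2) (rad / 2)); first by rewrite lt_min gt_min r2 orbT !divr_gt0.
move=> u u0; rewrite le_min => /andP[ud ur].
have ur' : u < rad by have := rad_pos; lra.
rewrite (intL_ge0 L_pos L_int)//=.
have := hd u u0 ur'; rewrite subr0 intLxx subr0 (ger0_norm u0).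
by move=> /(_ ltac:(lra)) /(le_lt_trans (ler_norm _)).
Qed.

Lemma nu_le_rad : nu L rad <= rad.
Proof.
apply: ge_sup; first by exists 0; rewrite /= lexx rad_pos intLxx; split=> //; lra.
by move=> t [/andP[_ /ltW]].
Qed.

Lemma nu_gt0 : 0 < nu L rad.
Proof.
have [d /andP[d0 dr] hd] := intL0_small (@ltr01 R).
apply: (lt_le_trans d0); apply: ub_le_sup; first by exists rad => t [/andP[_ /ltW]].
split; first by rewrite (ltW d0).
by have /andP[_] := hd d (ltW d0) (lexx d); rewrite subr_lt0.
Qed.

Lemma intL0_lt1 t : 0 <= t -> t < nu L rad -> I0 t < 1.
Proof.
move=> t0 tn; have [t' [/andP[t'0 t'r] I1] tt'] := sup_gt_pos t0 tn.
rewrite subr_lt0 in I1; apply: le_lt_trans I1.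
by apply: (intL0_homo L_pos L_int) => //; exact: ltW.
Qed.

Lemma rho_le_nu : rho L rad <= nu L rad.
Proof.
have [->|ne] := eqVneq (rho L rad) 0; first exact: ltW nu_gt0.
apply: ge_sup; last by move=> d [/andP[_ /ltW]].
by apply/set0P; apply: contra_neq ne => S0; rewrite /rho S0 sup0.
Qed.

(** The scalar Newton map: applied to an upper bound for the distance of an
    iterate to the solution it bounds the distance of the next iterate. *)
Definition majorant t := J t / (1 - I0 t).

Lemma intLu_le t : 0 <= t -> t < rad -> J t <= t * I0 t.
Proof.
move=> t0 tr; have /andP[_] := intLu_itv_bounds L_pos L_int (lexx 0) t0 tr.
by rewrite intLu0 subr0.
Qed.

Lemma rho_gt0 : 0 < rho L rad.
Proof.
have [d /andP[d0 dr] hd] := intL0_small (divr_gt0 (@ltr01 R) (ltr0n R 2)).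
pose e := Num.min d (nu L rad / 2).
have n0 := nu_gt0.
have e0 : 0 < e by rewrite lt_min d0 divr_gt0.
apply: (lt_le_trans e0); apply: ub_le_sup.
  by exists (nu L rad) => t [/andP[_ /ltW]].
have en : e < nu L rad.
  have : e <= nu L rad / 2 by rewrite ge_min lexx orbT.
  lra.
have ed : e <= d by rewrite ge_min lexx.
split; first by rewrite e0.
move=> t /andP[t0 te].
have td : t <= d by rewrite (le_trans (ltW te)).
have /andP[I_0 I_1] := hd t (ltW t0) td.
have tr : t < rad by rewrite (le_lt_trans td).
rewrite ltr_pdivrMr; last by rewrite mulr_gt0//; lra.
rewrite mul1r (le_lt_trans (intLu_le (ltW t0) tr))// ltr_pM2l//; lra.
Qed.

Lemma lt_rho_rad t : t < rho L rad -> t < rad.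
Proof. by move=> /lt_le_trans; apply; rewrite (le_trans rho_le_nu)// nu_le_rad. Qed.

Lemma lt_rho_nu t : t < rho L rad -> t < nu L rad.
Proof. by move=> /lt_le_trans; apply; exact: rho_le_nu. Qed.

Lemma majorant_contracts t : 0 < t -> t < rho L rad -> J t < t * (1 - I0 t).
Proof.
move=> t0 tr; have [d [_ hd] td] := sup_gt_pos (ltW t0) tr.
have := hd t; rewrite t0 td => /(_ isT); rewrite ltr_pdivrMr ?mul1r//.
by rewrite mulr_gt0// subr_gt0 intL0_lt1 ?ltW// lt_rho_nu.
Qed.

Lemma majorant_lt t : 0 < t -> t < rho L rad -> majorant t < t.
Proof.
move=> t0 tr; rewrite ltr_pdivrMr; first exact: majorant_contracts.
by rewrite subr_gt0 intL0_lt1 ?ltW// lt_rho_nu.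
Qed.

Lemma majorant_gt0 t : 0 < t -> t < nu L rad -> 0 < majorant t.
Proof.
move=> t0 tn; rewrite divr_gt0 ?subr_gt0 ?intL0_lt1 ?ltW//.
by rewrite (intLu_gt0 L_pos L_int)// t0 (lt_le_trans tn)// nu_le_rad.
Qed.

Lemma intLu_homo a b : 0 <= a -> a <= b -> b < rad -> J a <= J b.
Proof.
move=> a0 ab br; have /andP[+ _] := intLu_itv_bounds L_pos L_int a0 ab br.
move=> h; rewrite -subr_ge0 (le_trans _ h)// mulr_ge0//.
exact: (intL_ge0 L_pos L_int).
Qed.

Lemma intLu_ge0 t : 0 <= t -> t < rad -> 0 <= J t.
Proof. by move=> t0 tr; have := intLu_homo (lexx 0) t0 tr; rewrite intLu0. Qed.

Lemma one_sub_intL0_gt0 t : 0 <= t -> t < nu L rad -> 0 < 1 - I0 t.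
Proof. by move=> t0 tn; rewrite subr_gt0 intL0_lt1. Qed.

Lemma majorant_homo a b : 0 <= a -> a <= b -> b < nu L rad ->
  majorant a <= majorant b.
Proof.
move=> a0 ab bn; have b0 := le_trans a0 ab.
have br := lt_le_trans bn nu_le_rad.
apply: ler_pM; rewrite ?intLu_ge0 ?intLu_homo//; first exact: le_lt_trans br.
  by rewrite invr_ge0 ltW// one_sub_intL0_gt0// (le_lt_trans ab).
rewrite lef_pV2 ?posrE ?one_sub_intL0_gt0//; last exact: le_lt_trans bn.
by rewrite lerD2l lerN2 (intL0_homo L_pos L_int).
Qed.

(** The factor I0 t / (1 - I0 t) tends to 0 with t, hence superlinear convergence. *)
Lemma majorant_ratio_le t : 0 <= t -> t < nu L rad ->
  majorant t <= t * (I0 t / (1 - I0 t)).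
Proof.
move=> t0 tn; rewrite /majorant mulrA ler_pM2r ?invr_gt0 ?one_sub_intL0_gt0//.
by rewrite intLu_le// (lt_le_trans tn)// nu_le_rad.
Qed.

Section Sigma.
Variable kap : R.
Hypothesis kap_gt0 : 0 < kap.
Hypothesis kap_le_rad : kap <= rad.

Lemma sigma_gt0 : 0 < sigma L kap.
Proof.
have [d /andP[d0 dr] hd] := intL0_small (@ltr01 R).
pose e := Num.min d (kap / 2).
have e0 : 0 < e by rewrite lt_min d0 divr_gt0.
apply: (lt_le_trans e0); apply: ub_le_sup; first by exists kap => t [/andP[_ /ltW]].
have ek : e < kap.
  have : e <= kap / 2 by rewrite ge_min lexx orbT.
  by have := kap_gt0; lra.
have er := lt_le_trans ek kap_le_rad.
have ed : e <= d by rewrite ge_min lexx.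
split; first by rewrite e0.
rewrite (intL_mul_sub L_int (ltW e0) er).
have /andP[_ I1] := hd e (ltW e0) ed.
have : e * I0 e < e * 1 by rewrite ltr_pM2l.
have := intLu_ge0 (ltW e0) er; lra.
Qed.

(** The function psi t = t \int_0^t L - \int_0^t L(u) u du - t is convex and
    vanishes at 0, so it is negative on all of (0, t') once it is negative at t'. *)
Lemma lt_sigma t : 0 < t -> t < sigma L kap -> t < kap /\ t * I0 t - J t < t.
Proof.
move=> t0 ts; have [t' [/andP[t'0 t'k] Wt'] tt'] := sup_gt_pos (ltW t0) ts.
have t'r := lt_le_trans t'k kap_le_rad.
split; first exact: lt_trans t'k.
move: Wt'; rewrite (intL_mul_sub L_int (ltW t'0) t'r) => Wt'.
have /andP[_ J1] := intLu_itv_bounds L_pos L_int (ltW t0) (ltW tt') t'r.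
have chasles := intL_chasles L_int (lexx 0) (ltW t0) (ltW tt') t'r.
have Jt0 := intLu_ge0 (ltW t0) (lt_trans tt' t'r).
rewrite ltNge; apply/negP => Wt.
have I1 : 1 <= I0 t by rewrite -(ler_pM2l t0) mulr1; lra.
have : (t' - t) * 1 <= (t' - t) * I0 t by rewrite ler_wpM2l// subr_ge0 ltW.
by move: Wt'; rewrite chasles; lra.
Qed.

End Sigma.

Section Iterates.
Variable t0 : R.
Hypothesis t0_gt0 : 0 < t0.
Hypothesis t0_lt : t0 < rho L rad.

Local Notation t := (majorant_seq L t0).

Lemma majorant_seqS k : t k.+1 = majorant (t k).
Proof. by []. Qed.

Lemma majorant_seq_bounds k : 0 < t k <= t0.
Proof.
elim: k => [|k /andP[tk0 tkt]]; first by rewrite t0_gt0 /=.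
have tr := le_lt_trans tkt t0_lt.
rewrite majorant_seqS majorant_gt0//=; last exact: lt_rho_nu.
by rewrite (le_trans _ tkt)// ltW// majorant_lt.
Qed.

Lemma majorant_seq_gt0 k : 0 < t k.
Proof. by case/andP: (majorant_seq_bounds k). Qed.

Lemma majorant_seq_lt_rho k : t k < rho L rad.
Proof. by case/andP: (majorant_seq_bounds k) => _ /le_lt_trans; apply. Qed.

Lemma majorant_seq_lt k : t k.+1 < t k.
Proof. by rewrite majorant_seqS majorant_lt ?majorant_seq_gt0 ?majorant_seq_lt_rho. Qed.

Lemma majorant_seq_decreasing : decreasing_seq t.
Proof. by apply/decreasing_seqP => k; exact: majorant_seq_lt. Qed.

(** A decreasing positive sequence has a limit l; if l were positive, continuity
    of \int_0^t L at l would make l a fixed point of the majorant, which has none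
    in (0, rho). *)
Lemma majorant_seq_cvg0 : t k @[k --> \oo] --> (0 : R).
Proof.
have lb : has_lbound (range t).
  by exists 0 => _ [k _ <-]; rewrite ltW// majorant_seq_gt0.
have dec : nonincreasing_seq t.
  by apply/nonincreasing_seqP => k; rewrite ltW// majorant_seq_lt.
have tc := nonincreasing_cvgn dec lb; set l := inf _ in tc.
have l_le k : l <= t k by apply: ge_inf => //; exists k.
have l0 : 0 <= l.
  apply: lb_le_inf; first by exists (t 0%N), 0%N.
  by move=> _ [k _ <-]; rewrite ltW// majorant_seq_gt0.
suff -> : 0 = l by [].
apply/eqP; rewrite eq_le l0 /= leNgt; apply/negP => lpos.
have lr : l < rho L rad := le_lt_trans (l_le 0%N) t0_lt.
have lrad := lt_rho_rad lr.
(* Below rho the majorant lies strictly under the diagonal; by continuity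
   t_(k+1) would fall below l as soon as t_k is close to l. *)
have gap : 0 < l * (1 - I0 l) - J l by rewrite subr_gt0 majorant_contracts.
have tl0 : 0 < t0 + l by rewrite addr_gt0.
have [d d0 hd] := intL_continuous L_int l0 lrad (divr_gt0 gap tl0).
have [k hk] : exists k, `|l - t k| < d.
  have /cvgrPdist_lt/(_ d d0) H := tc.
  by have [k] := @filter_ex _ \oo _ _ H; exists k.
have /andP[tk0 tkt0] := majorant_seq_bounds k.
have tkr := majorant_seq_lt_rho k.
have := hd (t k) (ltW tk0) (lt_rho_rad tkr); rewrite distrC => /(_ hk).
rewrite ltr_norml => /andP[_]; rewrite ltr_pdivlMr// => h1.
have /andP[_ h2] := intLu_itv_bounds L_pos L_int l0 (l_le k) (lt_rho_rad tkr).
have I1 : 0 < 1 - I0 (t k) by rewrite one_sub_intL0_gt0 ?ltW// lt_rho_nu.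
have h3 : l * (1 - I0 (t k)) <= J (t k).
  by rewrite -ler_pdivlMr//; exact: (l_le k.+1).
have h4 := intL_chasles L_int (lexx 0) l0 (l_le k) (lt_rho_rad tkr).
have h5 : t k * intL L l (t k) <= t0 * intL L l (t k).
  by rewrite ler_wpM2r// (intL_ge0 L_pos L_int)// lt_rho_rad.
move: h1 h2 h3 h5; rewrite h4; set K := intL L l (t k); nra.
Qed.

Definition majorant_rate k := I0 (t k) / (1 - I0 (t k)).

Lemma majorant_rate_ge0 k : 0 <= majorant_rate k.
Proof.
have tk := ltW (majorant_seq_gt0 k); have tr := majorant_seq_lt_rho k.
rewrite divr_ge0 ?(intL_ge0 L_pos L_int)//; first exact: lt_rho_rad.
by rewrite ltW// one_sub_intL0_gt0// lt_rho_nu.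
Qed.

Lemma majorant_rate_cvg0 : majorant_rate k @[k --> \oo] --> (0 : R).
Proof.
suff Ic : I0 (t k) @[k --> \oo] --> (0 : R).
  rewrite -[X in _ --> X](mul0r (1 - 0)^-1); apply: cvgM => //.
  by apply: cvgV; [rewrite subr0 oner_eq0|apply: cvgB => //; exact: cvg_cst].
apply/cvgrPdist_lt => e e0.
have [d /andP[d0 dr] hd] := intL0_small e0.
have /cvgrPdist_lt/(_ d d0) := majorant_seq_cvg0; apply: filterS => k.
have tk := majorant_seq_gt0 k.
rewrite !sub0r !normrN (gtr0_norm tk) => /ltW tkd.
by have /andP[I_ge I_lt] := hd _ (ltW tk) tkd; rewrite ger0_norm.
Qed.

Lemma majorant_seq_superlinear : t k.+1 / t k @[k --> \oo] --> (0 : R).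
Proof.
apply: (squeeze_cvgr _ (@cvg_cst _ 0 _ _ _) majorant_rate_cvg0).
apply: nearW => k; have tk := majorant_seq_gt0 k.
rewrite (ltW (divr_gt0 (majorant_seq_gt0 k.+1) tk)) andTb.
rewrite ler_pdivrMr// mulrC majorant_seqS.
by rewrite majorant_ratio_le ?ltW// lt_rho_nu// majorant_seq_lt_rho.
Qed.

End Iterates.

Section PowerRate.
Variable p : R.
Hypothesis p01 : 0 <= p <= 1.
Hypothesis L_mono : forall u v : R, 0 < u -> u <= v -> v < nu L rad ->
  u `^ (1 - p) * L u <= v `^ (1 - p) * L v.

(** The moment divided by t^(p+1) is nondecreasing and 1 / (1 - \int_0^t L) is
    strictly increasing because L is positive. *)
Lemma majorant_powR_ratio_lt a b : 0 < a -> a < b -> b < nu L rad ->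
  majorant a / a `^ (p + 1) < majorant b / b `^ (p + 1).
Proof.
move=> a0 ab bn; have b0 := lt_trans a0 ab.
have br := lt_le_trans bn nu_le_rad.
have A0 : 0 < a `^ (p + 1) by rewrite powR_gt0.
have B0 : 0 < b `^ (p + 1) by rewrite powR_gt0.
have := intLu_powR_scale L_pos L_int p01 nu_le_rad L_mono a0 ab bn.
have Ja : 0 < J a by rewrite (intLu_gt0 L_pos L_int)// a0 (lt_trans ab).
have Ib := one_sub_intL0_gt0 (ltW b0) bn.
have IaIb : 1 - I0 b < 1 - I0 a.
  rewrite ltrD2l ltrN2 (intL_chasles L_int (lexx 0) (ltW a0) (ltW ab) br) ltrDl.
  by rewrite (intL_gt0 L_pos L_int)// ltW.
have Ia := lt_trans Ib IaIb.
have Jb : 0 < J b by rewrite (intLu_gt0 L_pos L_int)// b0.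
move=> h; rewrite /majorant -!mulrA -!invfM.
rewrite ltr_pdivrMr ?mulr_gt0// mulrAC ltr_pdivlMr ?mulr_gt0//.
rewrite [ltLHS](_ : _ = b `^ (p + 1) * J a * (1 - I0 b)); last by ring.
rewrite [ltRHS](_ : _ = a `^ (p + 1) * J b * (1 - I0 a)); last by ring.
apply: (@le_lt_trans _ _ (a `^ (p + 1) * J b * (1 - I0 b))).
  by rewrite ler_pM2r.
by rewrite ltr_pM2l// mulr_gt0.
Qed.

End PowerRate.

End MajorantSequence.

(** * One Gauss-Newton step *)

Section NewtonEstimates.
Variables (R : realType) (s : scalar_kind) (X Y : hilbertType R s).
Variables (Omega : set X) (F : X -> Y) (xs : X) (rad : R) (L : R -> R).
Hypothesis hyp : newton_hyp Omega F xs rad L.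

Local Notation kap := (kappa rad Omega xs).
Local Notation I0 := (intL L 0).
Local Notation J := (intLu L).
Local Notation beta := (opnorm (moore_penrose ('d F xs))).

Let rad0 : 0 < rad := rad_gt0 hyp.
Let Lpos := L_gt0 hyp.
Let Lint := L_integrable hyp.

Lemma kappa_has_sup : has_sup [set t | 0 <= t < rad /\ oball xs t `<=` Omega].
Proof.
split; last by exists rad => t [/andP[_ /ltW]].
exists 0; split; first by rewrite lexx.
by move=> x; rewrite /oball /= ltNge rnorm_ge0.
Qed.

Lemma kappa_le_rad : kap <= rad.
Proof.
apply: ge_sup; first by case: kappa_has_sup.
by move=> t [/andP[_ /ltW]].
Qed.

Lemma kappa_gt0 : 0 < kap.
Proof.
have /nbhs_oball[e e0 he] := open_nbhs_nbhs (conj (Omega_open hyp) (xs_Omega hyp)).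
pose t := Num.min e (rad / 2).
have t0 : 0 < t by rewrite lt_min e0 divr_gt0.
apply: lt_le_trans t0 _; apply: ub_le_sup; first by case: kappa_has_sup.
have tr : t < rad.
  have : t <= rad / 2 by rewrite ge_min lexx orbT.
  by have := rad0; lra.
split; first by rewrite tr le_min (ltW e0) divr_ge0// ltW.
move=> x xt; apply: he; apply: lt_le_trans xt _.
by rewrite ge_min lexx.
Qed.

Lemma kappa_ball : oball xs kap `<=` Omega.
Proof.
move=> x; rewrite /oball /= -subr_gt0 => /sup_adherent/(_ kappa_has_sup).
by move=> [t [_ tO]]; rewrite opprB addrCA subrr addr0 => xt; exact: tO.
Qed.

Lemma dF_linear_bounded x : Omega x ->
  exists2 C, 0 < C & forall h, rnorm ('d F x h) <= C * rnorm h.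
Proof.
move=> Ox; apply: linear_rnorm_bounded; apply: diff_continuous.
by case: (F_C1 hyp) => + _; exact.
Qed.

Lemma differentiable_Omega x : Omega x -> differentiable F x.
Proof. by case: (F_C1 hyp) => + _; exact. Qed.

Lemma le_beta (v : X) : rnorm v <= beta * rnorm ('d F xs v).
Proof.
have Ox := xs_Omega hyp.
have [C C0 AC] := dF_linear_bounded Ox.
have [c c0 Ac] := closed_range_bounded_below
  (diff_continuous (differentiable_Omega Ox)) (dF_xs_inj hyp) (dF_closed hyp Ox).
exact: le_opnorm_moore_penrose c0 Ac AC v.
Qed.

Lemma beta_gt0 (v : X) : v != 0 -> 0 < beta.
Proof.
move=> v0; rewrite lt_def opnorm_ge0 andbT; apply: contraNN v0 => /eqP b0.
by have := le_beta v; rewrite b0 mul0r -rnorm_eq0 eq_le rnorm_ge0 andbT.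
Qed.

Lemma dF_dist (x y v : X) : Omega x -> Omega y ->
  rnorm ('d F x v - 'd F y v) <= opnorm (fun h => 'd F x h - 'd F y h) * rnorm v.
Proof.
move=> Ox Oy; have [C _ hC] := dF_linear_bounded Ox.
have [D _ hD] := dF_linear_bounded Oy.
apply: (@opnorm_bound _ _ _ _ (fun h => 'd F x h - 'd F y h) (C + D)).
  by move=> a h; rewrite ![_ (scalar_of s a *: h)]linearZ_real -scalerBr.
move=> h; rewrite (le_trans (ler_rnormD _ _))// rnormN mulrDl.
by apply: lerD; [exact: hC|exact: hD].
Qed.

Lemma oball_radial (r : R) v t : rnorm v < r -> 0 <= t <= 1 ->
  oball xs r (xs + scalar_of s t *: v).
Proof.
move=> vr /andP[t0 t1]; rewrite /oball /= addrAC subrr add0r rnormZ ger0_norm//.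
by apply: le_lt_trans vr; rewrite ler_piMl ?rnorm_ge0.
Qed.

(** The hypothesis on F, with the operator norm evaluated at a direction and the
    integral written as a difference. *)
Lemma lipschitz_dF tau (v w : X) : rnorm v < kap -> 0 <= tau <= 1 ->
  beta * rnorm ('d F (xs + v) w - 'd F (xs + scalar_of s tau *: v) w)
    <= (I0 (rnorm v) - I0 (tau * rnorm v)) * rnorm w.
Proof.
move=> vk tau01; have /andP[tau0 tau1] := tau01.
have one01 : 0 <= (1 : R) <= 1 by rewrite ler01 lexx.
have Bv : oball xs kap (xs + v).
  by have := oball_radial vk one01; rewrite scalar_of1 scale1r.
have Bt := oball_radial vk tau01.
have := L_lipschitz hyp tau01 Bv; rewrite (addrAC xs) subrr add0r => lip.
have vr : rnorm v < rad by exact: lt_le_trans vk kappa_le_rad.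
have tv : tau * rnorm v <= rnorm v by rewrite ler_piMl ?rnorm_ge0.
have tv0 : 0 <= tau * rnorm v by rewrite mulr_ge0 ?rnorm_ge0.
have -> : I0 (rnorm v) - I0 (tau * rnorm v) = intL L (tau * rnorm v) (rnorm v).
  by rewrite (intL_chasles Lint (lexx 0) tv0 tv vr) addrAC subrr add0r.
rewrite (le_trans _ (ler_wpM2r (rnorm_ge0 w) lip))// -mulrA.
by rewrite ler_wpM2l ?opnorm_ge0// dF_dist//; exact: kappa_ball.
Qed.

Lemma intL0_continuous_segment (r : R) : r < rad -> forall a e, 0 <= a <= r -> 0 < e ->
  exists2 d, 0 < d & forall b, 0 <= b <= r -> `|b - a| < d -> `|I0 b - I0 a| < e.
Proof.
move=> rr a e /andP[a0 ar] e0.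
have [d d0 hd] := intL_continuous Lint a0 (le_lt_trans ar rr) e0.
by exists d => // b /andP[b0 br]; apply: hd => //; exact: le_lt_trans rr.
Qed.

(** Along the segment xs + t v the derivative of F - F'(xs + v), times beta, is at
    most |v| times the integral of L from t |v| to |v|; integrated over t in
    [0, 1] this is the first moment of L over [0, |v|]. *)
Lemma linearization_error v : v != 0 -> rnorm v < kap ->
  beta * rnorm (F (xs + v) - 'd F (xs + v) v) <= J (rnorm v).
Proof.
move=> v0 vk; have vr := lt_le_trans vk kappa_le_rad.
have r0 := rnorm_ge0 v.
have one01 : 0 <= (1 : R) <= 1 by rewrite ler01 lexx.
have Ox t : 0 <= t <= 1 -> Omega (xs + scalar_of s t *: v).
  by move=> t01; apply/kappa_ball/oball_radial.
have Oxv : Omega (xs + v) by have := Ox 1 one01; rewrite scalar_of1 scale1r.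
have -> : F (xs + v) - 'd F (xs + v) v = F (xs + v) - F xs - 'd F (xs + v) v.
  by rewrite (F_xs hyp) subr0.
pose h a := I0 (rnorm v) - I0 a.
(* H is a primitive of h; h is nonincreasing. *)
pose H a := a * h a + J a.
have -> : J (rnorm v) = H (rnorm v) - H 0.
  by rewrite /H /h subrr mulr0 add0r mul0r add0r intLu0 subr0.
apply: (@mean_value_radial _ _ _ _ F ('d F (xs + v)) xs v beta h H).
- exact: beta_gt0 v0.
- exact/diff_continuous/differentiable_Omega.
- by move=> t t01; apply: differentiable_Omega; exact: Ox.
- by move=> t t01; rewrite rdistC /h; exact: lipschitz_dF.
- by move=> a /andP[a0 ar]; rewrite subr_ge0 (intL0_homo Lpos Lint).
- move=> a e a01 e0; have [d d0 hd] := intL0_continuous_segment vr a01 e0.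
  exists d => // b b01 /(hd b b01); rewrite /h.
  have -> : I0 (rnorm v) - I0 b - (I0 (rnorm v) - I0 a) = - (I0 b - I0 a) by ring.
  by rewrite normrN.
- move=> a b a0 ab bv; have br := le_lt_trans bv vr.
  have /andP[+ _] := intLu_itv_bounds Lpos Lint a0 ab br.
  have := intL_chasles Lint (lexx 0) a0 ab br.
  have := intL_ge0 Lpos Lint a0 ab br.
  rewrite (_ : Num.min (h a) (h b) = h b); last first.
    by apply/min_idPr; rewrite lerD2l lerN2 (intL0_homo Lpos Lint).
  rewrite /H /h => ab0 -> Jab; lra.
Qed.

(** Linearising at xs instead, the integral of L runs from 0 to t |v|: this is the
    hypothesis for tau = 0 at the point xs + t v. *)
Lemma linearization_error_at_zero v : v != 0 -> rnorm v < kap ->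
  beta * rnorm (F (xs + v) - 'd F xs v) <= rnorm v * I0 (rnorm v) - J (rnorm v).
Proof.
move=> v0 vk; have vr := lt_le_trans vk kappa_le_rad.
have Ox t : 0 <= t <= 1 -> Omega (xs + scalar_of s t *: v).
  by move=> t01; apply/kappa_ball/oball_radial.
have -> : F (xs + v) - 'd F xs v = F (xs + v) - F xs - 'd F xs v.
  by rewrite (F_xs hyp) subr0.
(* H is a primitive of I0, which is nondecreasing. *)
pose H a := a * I0 a - J a.
have -> : rnorm v * I0 (rnorm v) - J (rnorm v) = H (rnorm v) - H 0.
  by rewrite /H mul0r intLu0 !subr0.
apply: (@mean_value_radial _ _ _ _ F ('d F xs) xs v beta I0 H).
- exact: beta_gt0 v0.
- by apply: diff_continuous; apply: differentiable_Omega; exact: xs_Omega hyp.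
- by move=> t t01; apply: differentiable_Omega; exact: Ox.
- move=> t t01; have /andP[t0 t1] := t01.
  have tvk : rnorm (scalar_of s t *: v) < kap.
    by rewrite rnormZ ger0_norm// (le_lt_trans _ vk)// ler_piMl ?rnorm_ge0.
  have zero01 : 0 <= (0 : R) <= 1 by rewrite lexx ler01.
  have := lipschitz_dF v tvk zero01.
  by rewrite scalar_of0 scale0r addr0 mul0r intLxx subr0 rnormZ ger0_norm.
- by move=> a /andP[a0 ar]; rewrite (intL_ge0 Lpos)// (le_lt_trans ar).
- move=> a e a01 e0; exact: intL0_continuous_segment.
- move=> a b a0 ab bv; have br := le_lt_trans bv vr.
  have /andP[_] := intLu_itv_bounds Lpos Lint a0 ab br.
  have := intL_chasles Lint (lexx 0) a0 ab br.
  rewrite (_ : Num.min (I0 a) (I0 b) = I0 a); last exact/min_idPl/(intL0_homo Lpos Lint).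
  rewrite /H => -> Jab; lra.
Qed.

(** A perturbation of the injective operator F'(xs), bounded below by 1 / beta, by
    an operator of norm at most (\int_0^|v| L) / beta. *)
Lemma dF_bounded_below v : v != 0 -> rnorm v < kap -> forall w,
  (1 - I0 (rnorm v)) / beta * rnorm w <= rnorm ('d F (xs + v) w).
Proof.
move=> v0 vk w; have b0 := beta_gt0 v0.
have zero01 : 0 <= (0 : R) <= 1 by rewrite lexx ler01.
have := lipschitz_dF w vk zero01.
rewrite scalar_of0 scale0r addr0 mul0r intLxx subr0 rdistC => lip.
have := le_beta w.
have := ler_rdistD ('d F (xs + v) w) ('d F xs w) 0; rewrite !subr0 => tri.
rewrite mulrAC ler_pdivrMr// => wb.
have : beta * rnorm ('d F xs w) <= beta * rnorm ('d F xs w - 'd F (xs + v) w)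
   + beta * rnorm ('d F (xs + v) w) by rewrite -mulrDr ler_pM2l.
lra.
Qed.

Lemma injective_dF v : rnorm v < kap -> I0 (rnorm v) < 1 ->
  injective ('d F (xs + v)).
Proof.
have [->|v0] := eqVneq v 0; first by rewrite addr0 => _ _; exact: dF_xs_inj hyp.
move=> vk I1 w1 w2 e; apply/eqP; rewrite -subr_eq0 -rnorm_eq0 eq_le rnorm_ge0 andbT.
have c0 : 0 < (1 - I0 (rnorm v)) / beta.
  by rewrite divr_gt0 ?subr_gt0//; exact: beta_gt0 v0.
rewrite -(ler_pM2l c0) mulr0 (le_trans (dF_bounded_below v0 vk _))//.
by rewrite linearB e subrr rnorm0.
Qed.

(** With B = F'(x) and v = x - xs, the next error is v minus the least-squares
    solution of B h = F x, hence at most |B v - F x| divided by the lower bound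
    of B. *)
Lemma gauss_newton_step x : rnorm (x - xs) < kap -> I0 (rnorm (x - xs)) < 1 ->
  rnorm (x - moore_penrose ('d F x) (F x) - xs) <=
    J (rnorm (x - xs)) / (1 - I0 (rnorm (x - xs))).
Proof.
have [v ->] : exists v, x = xs + v by exists (x - xs); rewrite addrC subrK.
rewrite [xs + v - _ - _]addrAC (addrAC xs v) subrr add0r.
have [->|v0] := eqVneq v 0.
  rewrite addr0 rnorm0 intLu0 mul0r (F_xs hyp) sub0r rnormN => _ _.
  have Ox := xs_Omega hyp.
  have [C C0 AC] := dF_linear_bounded Ox.
  have [c c0 Ac] := closed_range_bounded_below
    (diff_continuous (differentiable_Omega Ox)) (dF_xs_inj hyp) (dF_closed hyp Ox).
  by rewrite -(linear0 ('d F xs)) (moore_penroseK c0 Ac AC) rnorm0.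
move=> vk I1; have b0 := beta_gt0 v0.
have c0 : 0 < (1 - I0 (rnorm v)) / beta by rewrite divr_gt0 ?subr_gt0.
have Oxv : Omega (xs + v) by apply: kappa_ball; rewrite /oball /= addrAC subrr add0r.
have [C C0 BC] := dF_linear_bounded Oxv.
have := moore_penrose_dist c0 (dF_bounded_below v0 vk) BC v (F (xs + v)).
rewrite ler_pdivlMr ?subr_gt0// mulrAC ler_pdivrMr// mulrC => h.
rewrite (le_trans h)// mulrC rdistC.
exact: linearization_error.
Qed.

(** A zero xs + v would give |v| <= beta |F'(xs) v| <= |v| \int_0^|v| L -
    \int_0^|v| L(u) u du, which is smaller than |v| below sigma. *)
Lemma zero_unique y : oball xs (sigma L kap) y -> F y = 0 -> y = xs.
Proof.
have [v ->] : exists v, y = xs + v by exists (y - xs); rewrite addrC subrK.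
rewrite /oball /= addrAC subrr add0r.
have [->|v0] := eqVneq v 0; first by rewrite addr0.
move=> vs Fv; have v_gt0 : 0 < rnorm v by rewrite rnorm_gt0.
have [vk W] := lt_sigma Lpos Lint kappa_le_rad v_gt0 vs.
have := linearization_error_at_zero v0 vk.
by rewrite Fv sub0r rnormN => /(le_trans (le_beta v)); rewrite leNgt W.
Qed.

End NewtonEstimates.

(** * A function on the line attaining the radius *)

Section RealLine.
Variable R : realType.

Definition mulr_form (x y : R^o) : R := x * y.

Lemma mulr_form_linear1 y : linear_for ( *%R ) (mulr_form ^~ y).
Proof. by move=> a u v; rewrite /mulr_form mulrDl -mulrA. Qed.

Lemma mulr_form_linear2 x : linear_for (idfun \; *%R) (mulr_form x).
Proof. by move=> a u v; rewrite /mulr_form mulrDr mulrCA. Qed.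

HB.instance Definition _ := @bilinear_isBilinear.Build R R^o R^o R ( *%R )
  (idfun \; *%R) mulr_form (conj mulr_form_linear1 mulr_form_linear2).
Lemma mulr_form_sym (x y : R^o) : mulr_form x y = (-1) ^+ false * idfun (mulr_form y x).
Proof. by rewrite expr0 mul1r /mulr_form mulrC. Qed.
HB.instance Definition _ := @isHermitianSesquilinear.Build R R^o false idfun
  mulr_form mulr_form_sym.
Lemma mulr_form_gt0 (x : R^o) : x != 0 -> 0 < mulr_form x x.
Proof. by move=> x0; rewrite /mulr_form -expr2 lt_def sqr_ge0 sqrf_eq0 x0. Qed.
HB.instance Definition _ := isDotProduct.Build R R^o mulr_form mulr_form_gt0.

Lemma mulr_formxx (x : R^o) : mulr_form x x = `|x| ^+ 2.
Proof. by rewrite real_normK ?num_real. Qed.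

Definition realLine : hilbertType R RealScalars :=
  @HilbertType R RealScalars (R^o : completeNormedModType R) mulr_form mulr_formxx.

End RealLine.

Section OptimalRadius.
Variables (R : realType) (L : R -> R) (rad kap : R).
Local Notation mu := (@lebesgue_measure R).
Hypothesis rad_pos : 0 < rad.
Hypothesis L_pos : forall u, 0 <= u < rad -> 0 < L u.
Hypothesis L_int : mu.-integrable `[0, rad[ (EFin \o L).
Hypothesis kap_pos : 0 < kap.
Hypothesis kap_rad : kap <= rad.

Local Notation I0 := (intL L 0).
Local Notation J := (intLu L).

(** The odd primitive of x |-> \int_0^|x| L. *)
Definition radial_primitive (x : R) : R := Num.sg x * (`|x| * I0 `|x| - J `|x|).

Lemma radial_primitive0 : radial_primitive 0 = 0.
Proof. by rewrite /radial_primitive sgr0 mul0r. Qed.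

Lemma radial_primitiveN x : radial_primitive (- x) = - radial_primitive x.
Proof. by rewrite /radial_primitive sgrN normrN mulNr. Qed.

Lemma radial_primitive_ge0 x : 0 <= x -> radial_primitive x = x * I0 x - J x.
Proof.
rewrite le_eqVlt => /predU1P[<-|x0].
  by rewrite radial_primitive0 mul0r intLu0 subr0.
by rewrite /radial_primitive gtr0_sg// mul1r gtr0_norm.
Qed.

Lemma radial_primitive_increment_ge0 x y m M : 0 <= x -> x <= y -> y < rad ->
  (forall z, x <= z <= y -> m <= I0 `|z| <= M) ->
  (y - x) * m <= radial_primitive y - radial_primitive x <= (y - x) * M.
Proof.
move=> x0 xy yr IM; have y0 := le_trans x0 xy.
have xE : x <= x <= y by rewrite lexx.
have yE : x <= y <= y by rewrite lexx xy.
have /andP[+ _] := IM x xE; have /andP[_ +] := IM y yE.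
rewrite !ger0_norm// => IyM mIx.
have yx0 : 0 <= y - x by rewrite subr_ge0.
have h1 : (y - x) * I0 y <= (y - x) * M by rewrite ler_wpM2l.
have h2 : (y - x) * m <= (y - x) * I0 x by rewrite ler_wpM2l.
have /andP[J1 J2] := intLu_itv_bounds L_pos L_int x0 xy yr.
have ch := intL_chasles L_int (lexx 0) x0 xy yr.
rewrite !radial_primitive_ge0//; move: h1 h2 J1 J2; rewrite ch.
by move=> *; apply/andP; split; lra.
Qed.

(** The primitive property in integrated form: splitting at 0 and using oddness
    reduces it to the bounds for the moments, and it yields the derivative at
    every point, 0 included, by continuity of \int_0^|x| L. *)
Lemma radial_primitive_increment x y m M : - rad < x -> x <= y -> y < rad ->
  (forall z, x <= z <= y -> m <= I0 `|z| <= M) ->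
  (y - x) * m <= radial_primitive y - radial_primitive x <= (y - x) * M.
Proof.
move=> rx xy yr IM; have [x0|x0] := leP 0 x.
  exact: radial_primitive_increment_ge0.
have neg b : x <= b -> b <= 0 -> b <= y ->
    (b - x) * m <= radial_primitive b - radial_primitive x <= (b - x) * M.
  move=> xb b0 bY.
  have := @radial_primitive_increment_ge0 (- b) (- x) m M.
  rewrite oppr_ge0 lerN2 !radial_primitiveN !opprK => H.
  have [|||z /andP[z1 z2]|A B] := andP (H _ _ _ _); [lra|lra|lra| |].
    by rewrite -normrN; apply: IM; apply/andP; split; lra.
  by apply/andP; split; lra.
have [y0|y0] := leP y 0; first exact: neg.
have /andP[a1 a2] := neg 0 (ltW x0) (lexx 0) (ltW y0).
have /andP[b1 b2] : (y - 0) * m <= radial_primitive y - radial_primitive 0 <= (y - 0) * M.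
  apply: radial_primitive_increment_ge0 => //; first exact: ltW.
  by move=> z /andP[z1 z2]; apply: IM; apply/andP; split; lra.
by move: a1 a2 b1 b2; rewrite radial_primitive0 => *; apply/andP; split; lra.
Qed.

Lemma intL0_norm_continuous (x e : R) : `|x| < rad -> 0 < e ->
  exists2 d, 0 < d & forall z : R, `|z - x| < d -> `|z| < rad /\ `|I0 `|z| - I0 `|x| | < e.
Proof.
move=> xr e0; have [d d0 hd] := intL_continuous L_int (normr_ge0 x) xr e0.
exists (Num.min d (rad - `|x|)); first by rewrite lt_min d0 subr_gt0.
move=> z; rewrite lt_min => /andP[zd zr].
have tri := ler_dist_dist z x.
have zr' : `|z| < rad.
  have := ler_normD (z - x) x; rewrite subrK; lra.
by split => //; apply: hd => //; exact: le_lt_trans zd.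
Qed.

Lemma is_derive_eps (f : R -> R) (x l : R) :
  (forall e, 0 < e -> exists2 d, 0 < d & forall h, `|h| < d ->
     `|f (h + x) - f x - h * l| <= e * `|h|) ->
  is_derive x 1 f l.
Proof.
move=> hf.
have cf : (fun h => h^-1 *: ((f \o shift x) (h *: 1) - f x)) @ 0^' --> l.
  apply/cvgrPdist_le => e e0; have [d d0 hd] := hf e e0.
  near=> h; have h0 : h != 0 by near: h; exact: nbhs_dnbhs_neq.
  have hd' : `|h| < d by near: h; exact: dnbhs0_lt.
  have := hd h hd'; rewrite /= [h *: 1]mulr1 => H.
  rewrite -[_ *: _]/(h^-1 * _) distrC.
  have -> : h^-1 * (f (h + x) - f x) - l = h^-1 * (f (h + x) - f x - h * l).
    by rewrite [RHS]mulrBr mulKf.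
  by rewrite normrM normfV ler_pdivrMl ?normr_gt0// [leRHS]mulrC.
by split; [apply/cvg_ex; exists l|exact: cvg_lim].
Unshelve. all: by end_near. Qed.

Lemma is_derive_radial_primitive (x : R) : `|x| < rad ->
  is_derive x 1 radial_primitive (I0 `|x|).
Proof.
move=> xr; apply: is_derive_eps => e e0.
have [d d0 hd] := intL0_norm_continuous xr e0.
exists d => // h hlt.
have IM z : `|z - x| <= `|h| -> I0 `|x| - e <= I0 `|z| <= I0 `|x| + e.
  by move=> /le_lt_trans/(_ hlt)/hd[_]; rewrite ltr_norml => *; apply/andP; split; lra.
have hr : `|h + x| < rad by have [|+ _] := hd (h + x); rewrite ?addrK.
move: hr xr; rewrite !ltr_norml => /andP[hr1 hr2] /andP[xr1 xr2].
have [h0|h0] := leP 0 h.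
  have xhx : x <= h + x by rewrite lerDr.
  have [|] := andP (@radial_primitive_increment x (h + x)
    (I0 `|x| - e) (I0 `|x| + e) xr1 xhx hr2 _).
    move=> z /andP[z1 z2]; apply: IM.
    by rewrite !ger0_norm// ?subr_ge0//; lra.
  by rewrite addrK ler_norml (ger0_norm h0) => ? ?; apply/andP; split; lra.
have hxx : h + x <= x by rewrite gerDr ltW.
have [|] := andP (@radial_primitive_increment (h + x) x
  (I0 `|x| - e) (I0 `|x| + e) hr1 hxx xr2 _).
  move=> z /andP[z1 z2]; apply: IM.
  by rewrite (ltr0_norm h0) ler_norml; apply/andP; split; lra.
rewrite ler_norml (ltr0_norm h0) (_ : x - (h + x) = - h); last by ring.
by move=> ? ?; apply/andP; split; lra.
Qed.

(** Its derivative 1 - \int_0^|x| L turns the hypothesis on F into an equality, so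
    every estimate above is attained. *)
Definition sharp_map (x : realLine R) : realLine R := (x : R) - radial_primitive x.

Definition sharp_domain : set (realLine R) := [set x : R | `|x| < kap].

Lemma sharp_domain_rad (x : realLine R) : sharp_domain x -> `|x : R| < rad.
Proof. by move=> /lt_le_trans; exact. Qed.

Lemma differentiable_sharp_map (x : realLine R) : sharp_domain x ->
  differentiable sharp_map x /\
  forall h : realLine R, 'd sharp_map x h = (h : R) * (1 - I0 `|x : R|) :> R.
Proof.
move=> /sharp_domain_rad xr.
have dV := is_derive_radial_primitive xr.
have dF : is_derive (x : R) 1 (fun z : R => z - radial_primitive z) (1 - I0 `|x : R|).
  exact: is_deriveB.
have df : differentiable (fun z : R^o => z - radial_primitive z : R^o) (x : R^o).
  exact/derivable1_diffP/ex_derive.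
split; first exact: df.
move=> h; have := diff1E df; rewrite derive1E derive_val => E.
exact: (congr1 (fun g => g h) E).
Qed.

Lemma rnorm_realLine (x : realLine R) : rnorm x = `|x : R|.
Proof. by []. Qed.

Lemma oball0_realLine (t : R) (x : realLine R) :
  oball 0 t x = (`|x : R| < t) :> Prop.
Proof. by rewrite /oball /mkset subr0. Qed.

Lemma moore_penrose_sharp (x : realLine R) : sharp_domain x -> 1 - I0 `|x : R| != 0 ->
  forall y : realLine R,
    moore_penrose ('d sharp_map x) y = (y : R) / (1 - I0 `|x : R|) :> R.
Proof.
move=> xO d0 y; have [_ dE] := differentiable_sharp_map xO.
set d := 1 - _ in d0 dE *.
have dn w : rnorm ('d sharp_map x w) = `|d| * rnorm w.
  by rewrite !rnorm_realLine dE normrM mulrC.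
have c0 : 0 < `|d| by rewrite normr_gt0.
pose v : realLine R := (y : R) / d.
have yE : 'd sharp_map x v = y by rewrite [LHS]dE /v divfK.
have dn_ge w : `|d| * rnorm w <= rnorm ('d sharp_map x w) by rewrite dn.
have dn_le w : rnorm ('d sharp_map x w) <= `|d| * rnorm w by rewrite dn.
by rewrite -[RHS]/v -[RHS](moore_penroseK c0 dn_ge dn_le) yE.
Qed.

Lemma sharp_kappa : kappa rad sharp_domain 0 = kap.
Proof.
pose S := [set t | 0 <= t < rad /\ oball (0 : realLine R) t `<=` sharp_domain].
have S_le t : S t -> t <= kap.
  move=> [_ tO]; rewrite leNgt; apply/negP => kt.
  have /tO : oball (0 : realLine R) t (kap : R).
    by rewrite oball0_realLine gtr0_norm.
  by rewrite /sharp_domain /= gtr0_norm// ltxx.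
have S0 t : 0 <= t -> t < kap -> S t.
  move=> t0 tk; split; first by rewrite t0 (lt_le_trans tk).
  by move=> x; rewrite oball0_realLine => /lt_trans; apply.
have ub : has_ubound S by exists kap => t /S_le.
apply/eqP; rewrite eq_le ge_sup//=; last by exists 0; exact: S0.
rewrite leNgt; apply/negP => lt_k.
have {}lt_k : sup S < kap := lt_k.
have sup0 : 0 <= sup S by apply: ub_le_sup => //; exact: S0.
have : (sup S + kap) / 2 <= sup S.
  by apply: ub_le_sup => //; apply: S0; move: (sup S) sup0 lt_k => m; lra.
by move: (sup S) lt_k => m; lra.
Qed.

(** The derivative at 0 is the identity, so beta = 1, and the difference of two
    derivatives along a ray is the integral of L between the two radii. *)
Lemma sharp_newton_hyp : newton_hyp sharp_domain sharp_map (0 : realLine R) rad L.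
Proof.
have sharp0 : sharp_domain 0 by rewrite /sharp_domain /= normr0.
have dd x (xO : sharp_domain x) := (differentiable_sharp_map xO).1.
have dE x (xO : sharp_domain x) := (differentiable_sharp_map xO).2.
have opnorm_diff x y : sharp_domain x -> sharp_domain y ->
    opnorm (fun h => 'd sharp_map x h - 'd sharp_map y h) <= `|I0 `|x : R| - I0 `|y : R| |.
  move=> xO yO; apply: opnorm_le => // h; rewrite !rnorm_realLine.
  rewrite -[X in `|X|]/((_ : R) - _) (dE x xO) (dE y yO).
  rewrite -mulrBr normrM mulrC ler_wpM2r//.
  by rewrite opprB addrCA addrAC subrr add0r distrC.
have near_dom (x y : realLine R) : `|(y : R) - (x : R)| < kap - `|x : R| -> sharp_domain y.
  by move=> yx; rewrite /sharp_domain /=; have := ler_normD ((y : R) - (x : R)) x;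
    rewrite subrK; lra.
split => //.
- rewrite openE => x xO; apply/nbhs_oball; exists (kap - `|x : R|).
    by rewrite subr_gt0.
  by move=> y; exact: near_dom.
- split; first exact: dd.
  move=> x xO; apply/cvgrPdist_lt => e e0.
  have [d d0 hd] := intL0_norm_continuous (sharp_domain_rad xO) e0.
  apply: (nbhs_oball (x : realLine R) _).2; exists (Num.min d (kap - `|x : R|)).
    by rewrite lt_min d0 subr_gt0.
  move=> y; rewrite /oball /= lt_min => /andP[yd yk] /=.
  rewrite sub0r normrN ger0_norm ?opnorm_ge0//.
  by apply: (le_lt_trans (opnorm_diff _ _ (near_dom _ _ yk) xO)); exact: (hd y yd).2.
- move=> x xO; have [d0|d0] := eqVneq (1 - I0 `|x : R|) 0.
    rewrite (_ : range _ = [set h : realLine R | h = 0]); first exact: closed_eq.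
    apply/seteqP; split=> [_ [h _ <-]|h ->] /=; first by rewrite [LHS]dE// d0 mulr0.
    by exists 0 => //; exact: linear0.
  rewrite (_ : range _ = setT); first exact: closedT.
  apply/seteqP; split=> // y _; exists ((y : R) / (1 - I0 `|x : R|) : R) => //.
  by rewrite [LHS]dE// divfK.
- by rewrite /sharp_map radial_primitive0 subrr.
- move=> u v; have := dE 0 sharp0; rewrite normr0 intLxx subr0 => E uv.
  by have := E u; rewrite uv E !mulr1.
- move=> tau x /andP[tau0 tau1] xk.
  have xO : sharp_domain x by move: xk; rewrite sharp_kappa oball0_realLine.
  have txO : sharp_domain (0 + scalar_of RealScalars tau *: (x - 0)).
    rewrite add0r subr0 /sharp_domain /= normrM (ger0_norm tau0).
    by apply: le_lt_trans xO; rewrite ler_piMl.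
  have d1 : 1 - I0 `|0 : R| != 0 by rewrite normr0 intLxx subr0 oner_eq0.
  have mp1 : opnorm (moore_penrose ('d sharp_map (0 : realLine R))) <= 1.
    apply: opnorm_le => // y; rewrite mul1r !rnorm_realLine moore_penrose_sharp//.
    by rewrite normr0 intLxx subr0 divr1.
  have increment (a : R) : 0 <= a -> a < rad ->
      `|I0 a - I0 (tau * a)| = intL L (tau * a) a.
    move=> a0 ar; have ta0 : 0 <= tau * a by rewrite mulr_ge0.
    have ta : tau * a <= a by rewrite ler_piMl.
    rewrite ger0_norm ?subr_ge0 ?(intL0_homo L_pos L_int)//.
    by rewrite (intL_chasles L_int (lexx 0) ta0 ta ar) addrAC subrr add0r.
  rewrite -[leRHS]mul1r ler_pM ?opnorm_ge0//.
  apply: (le_trans (opnorm_diff _ _ xO txO)).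
  rewrite add0r subr0.
  have -> : `|I0 `|x : R| - I0 `|(tau * (x : R))%R| | =
      intL L (tau * `|x : R|) `|x : R|; last exact: lexx.
  rewrite normrM (ger0_norm tau0); apply: increment => //.
  exact: sharp_domain_rad.
Qed.

Definition sharp_newton (x : R) : R :=
  x - (x - radial_primitive x) / (1 - I0 `|x|).

Lemma sharp_newtonE (x : realLine R) : sharp_domain x -> 1 - I0 `|x : R| != 0 ->
  x - moore_penrose ('d sharp_map x) (sharp_map x) = sharp_newton x.
Proof. by move=> xO d0; rewrite moore_penrose_sharp. Qed.

Lemma sharp_newtonN x : sharp_newton (- x) = - sharp_newton x.
Proof. by rewrite /sharp_newton normrN radial_primitiveN; ring. Qed.

(** The step sends r to minus the majorant at r, which is - r when the quotient
    equals 1; by oddness the iterates alternate between r and - r. *)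
Lemma sharp_divergence r : 0 < r -> r < kap -> J r / (r * (1 - I0 r)) = 1 ->
  gauss_newton_defined sharp_domain sharp_map (r : realLine R) /\
  ~ cvg (gauss_newton sharp_map (r : realLine R) k @[k --> \oo]).
Proof.
move=> r0 rk rate1; have rn : `|r| = r by rewrite gtr0_norm.
have d0 : 1 - I0 r != 0.
  apply: contra_eq_neq rate1 => ->.
  by rewrite mulr0 invr0 mulr0 eq_sym oner_eq0.
have Jr : J r = r * (1 - I0 r).
  have := congr1 ( *%R^~ (r * (1 - I0 r))) rate1.
  by rewrite /= divfK ?mul1r// mulf_neq0// gt_eqF.
have flip : sharp_newton r = - r.
  rewrite /sharp_newton rn radial_primitive_ge0 ?ltW// Jr.
  by field.
pose x k : realLine R := gauss_newton sharp_map (r : realLine R) k.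
have xE k : x k = (-1) ^+ k * r :> R.
  elim: k => [|k IH]; first by rewrite expr0 mul1r.
  have xn : `|x k : R| = r by rewrite IH normrM normrX normrN1 expr1n mul1r.
  have xO : sharp_domain (x k) by rewrite /sharp_domain /= xn.
  have : x k.+1 = sharp_newton (x k) by rewrite -sharp_newtonE ?xn.
  move=> ->; rewrite IH exprS -mulrA mulN1r -signr_odd.
  by case: odd; rewrite ?expr1 ?expr0 ?mulN1r ?mul1r ?sharp_newtonN flip.
have xn k : `|x k : R| = r by rewrite xE normrM normrX normrN1 expr1n mul1r.
have xO k : sharp_domain (x k) by rewrite /sharp_domain /= xn.
split.
  move=> k; split; first exact: xO.
  move=> u v; have [_ dE] := differentiable_sharp_map (xO k).
  move=> uv; have := dE u; rewrite uv dE xn => /(mulIf d0); exact: esym.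
move=> /cvg_ex[l xl].
have /cvg_oball/(_ r r0) near_l := xl.
have [N _ hN] := near_l.
have h1 : `|(x N : R) - (l : R)| < r := hN N (leqnn N).
have h2 : `|(x N.+1 : R) - (l : R)| < r := hN N.+1 (leqnSn N).
have : `|(x N : R) - (x N.+1 : R)| < r + r.
  rewrite distrC in h2.
  exact: le_lt_trans (ler_distD (l : R) _ _) (ltrD h1 h2).
rewrite !xE exprS mulN1r mulNr opprK -mulr2n normrMn normrM normrX normrN1.
by rewrite expr1n mul1r rn mulr2n ltxx.
Qed.

End OptimalRadius.

(** * Convergence and rates *)

Section GaussNewton.
Variables (R : realType) (s : scalar_kind) (X Y : hilbertType R s).
Variables (Omega : set X) (F : X -> Y) (xs : X) (rad : R) (L : R -> R).
Hypothesis hyp : newton_hyp Omega F xs rad L.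

Local Notation kap := (kappa rad Omega xs).
Local Notation rhob := (rho L rad).
Local Notation rb := (Num.min kap rhob).

Let rad_pos : 0 < rad := rad_gt0 hyp.
Let L_pos := L_gt0 hyp.
Let L_int := L_integrable hyp.

Variable x0 : X.
Hypothesis x0_ball : oball xs rb x0.
Hypothesis x0_neq : x0 <> xs.

Local Notation t0 := (rnorm (x0 - xs)).
Local Notation x := (gauss_newton F x0).
Local Notation t := (majorant_seq L t0).

Lemma initial_error_gt0 : 0 < t0.
Proof. by rewrite rnorm_gt0 subr_eq0; apply/eqP. Qed.

Lemma initial_error_lt_rb : t0 < rb.
Proof. exact: x0_ball. Qed.

Lemma initial_error_lt_rho : t0 < rhob.
Proof. by have := initial_error_lt_rb; rewrite lt_min => /andP[]. Qed.

Lemma initial_error_lt_kap : t0 < kap.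
Proof. by have := initial_error_lt_rb; rewrite lt_min => /andP[]. Qed.

Lemma majorant_seq_in k : 0 < t k <= t0.
Proof.
exact: majorant_seq_bounds rad_pos L_pos L_int _ initial_error_gt0
  initial_error_lt_rho k.
Qed.

Lemma majorant_seq_lt_nu k : t k < nu L rad.
Proof.
have /andP[_ /le_lt_trans] := majorant_seq_in k; apply.
exact: lt_rho_nu rad_pos L_pos L_int _ initial_error_lt_rho.
Qed.

(** The majorant is monotone, so the bound for one step can be applied to t_k in
    place of |x_k - xs|. *)
Lemma gauss_newton_le k : rnorm (x k - xs) <= t k.
Proof.
elim: k => [|k IH]; first exact: lexx.
have /andP[tk0 tkt] := majorant_seq_in k.
have r0 := rnorm_ge0 (x k - xs).
apply: (@le_trans _ _ (majorant L (rnorm (x k - xs)))); last first.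
  exact: (majorant_homo rad_pos L_pos L_int r0 IH (majorant_seq_lt_nu k)).
apply: (gauss_newton_step hyp).
  by rewrite (le_lt_trans IH)// (le_lt_trans tkt)// initial_error_lt_kap.
by rewrite (intL0_lt1 L_pos L_int)// (le_lt_trans IH)// majorant_seq_lt_nu.
Qed.

Lemma gauss_newton_lt_nu k : rnorm (x k - xs) < nu L rad.
Proof. exact: le_lt_trans (gauss_newton_le k) (majorant_seq_lt_nu k). Qed.

Lemma gauss_newton_ball k : oball xs rb (x k).
Proof.
have /andP[_ tkt] := majorant_seq_in k.
by apply: le_lt_trans (gauss_newton_le k) _; apply: le_lt_trans tkt initial_error_lt_rb.
Qed.

Lemma gauss_newton_lt_kap k : rnorm (x k - xs) < kap.
Proof. by have := gauss_newton_ball k; rewrite /oball /= lt_min => /andP[]. Qed.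

Lemma gauss_newton_majorant k :
  rnorm (x k.+1 - xs) <= majorant L (rnorm (x k - xs)).
Proof.
apply: (gauss_newton_step hyp (gauss_newton_lt_kap k)).
by rewrite (intL0_lt1 L_pos L_int) ?rnorm_ge0// gauss_newton_lt_nu.
Qed.

Lemma gauss_newton_is_defined : gauss_newton_defined Omega F x0.
Proof.
move=> k; have xk := gauss_newton_lt_kap k.
split; first exact: (kappa_ball hyp).
have -> : gauss_newton F x0 k = xs + (x k - xs) by rewrite addrC subrK.
apply: (injective_dF hyp) => //.
by rewrite (intL0_lt1 L_pos L_int) ?rnorm_ge0// gauss_newton_lt_nu.
Qed.

Lemma gauss_newton_cvg : x k @[k --> \oo] --> xs.
Proof.
apply/cvg_oball => e e0.
have /cvgrPdist_lt/(_ e e0) := majorant_seq_cvg0 rad_pos L_pos L_int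
  initial_error_gt0 initial_error_lt_rho.
apply: filterS => k; rewrite sub0r normrN; apply: le_lt_trans.
exact: le_trans (gauss_newton_le k) (ler_norm _).
Qed.

Lemma gauss_newton_superlinear :
  rnorm (x k.+1 - xs) / rnorm (x k - xs) @[k --> \oo] --> (0 : R).
Proof.
apply: (squeeze_cvgr _ (@cvg_cst _ 0 _ _ _)
  (majorant_rate_cvg0 rad_pos L_pos L_int initial_error_gt0 initial_error_lt_rho)).
apply: nearW => k; rewrite divr_ge0 ?rnorm_ge0//=.
have [xk0|xk0] := eqVneq (rnorm (x k - xs)) 0.
  rewrite xk0 invr0 mulr0.
  exact: majorant_rate_ge0 rad_pos L_pos L_int _ initial_error_gt0 initial_error_lt_rho k.
have xk_gt0 : 0 < rnorm (x k - xs) by rewrite lt_def xk0 rnorm_ge0.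
rewrite ler_pdivrMr// (le_trans (gauss_newton_majorant k))//.
rewrite (le_trans (majorant_ratio_le rad_pos L_pos L_int (ltW xk_gt0)
  (gauss_newton_lt_nu k)))//.
rewrite mulrC ler_pM2r// /majorant_rate.
have tn := majorant_seq_lt_nu k; have /andP[tk0 _] := majorant_seq_in k.
have Itx := intL0_homo L_pos L_int (ltW xk_gt0) (gauss_newton_le k)
  (lt_le_trans tn (nu_le_rad L rad_pos)).
have It1 := intL0_lt1 L_pos L_int (ltW tk0) tn.
rewrite ler_pM ?invr_ge0 ?subr_ge0//.
- apply: (intL_ge0 L_pos L_int) => //; first exact: ltW.
  by rewrite (le_lt_trans (gauss_newton_le k))// (lt_le_trans tn)// nu_le_rad.
- by rewrite (le_trans Itx)// ltW.
- by rewrite lef_pV2 ?posrE ?subr_gt0 ?(le_lt_trans Itx)// lerD2l lerN2.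
Qed.

Section PowerRate.
Variable p : R.
Hypothesis p01 : 0 <= p <= 1.
Hypothesis L_mono : forall u v : R, 0 < u -> u <= v -> v < nu L rad ->
  u `^ (1 - p) * L u <= v `^ (1 - p) * L v.

Lemma power_rate_decreasing : decreasing_seq (fun k => t k.+1 / t k `^ (p + 1)).
Proof.
apply/decreasing_seqP => k.
have /andP[tk0 _] := majorant_seq_in k.+1.
apply: (majorant_powR_ratio_lt rad_pos L_pos L_int p01 L_mono tk0) (majorant_seq_lt_nu k).
exact: (majorant_seq_lt rad_pos L_pos L_int initial_error_gt0 initial_error_lt_rho).
Qed.

Lemma power_rate_le_first k : t k.+1 / t k `^ (p + 1) <= t 1%N / t0 `^ (p + 1).
Proof.
have := power_rate_decreasing; move=> /decreasing_seqP dec.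
elim: k => [|k IH]; first exact: lexx.
exact: le_trans (ltW (dec k)) IH.
Qed.

(** The majorant divided by t^(p+1) is increasing, and |x_k - xs| <= t_k. *)
Lemma gauss_newton_rate k : rnorm (x k.+1 - xs)
  <= t k.+1 / t k `^ (p + 1) * rnorm (x k - xs) `^ (p + 1)
  <= t 1%N / t0 `^ (p + 1) * rnorm (x k - xs) `^ (p + 1).
Proof.
have p1 : p + 1 != 0 by case/andP: p01 => p0 _; rewrite gt_eqF// ltr_wpDl.
rewrite (ler_wpM2r (powR_ge0 _ _) (power_rate_le_first k)) andbT.
apply: le_trans (gauss_newton_majorant k) _.
have [xk0|xk0] := eqVneq (rnorm (x k - xs)) 0.
  by rewrite xk0 powR0// mulr0 /majorant intLu0 mul0r.
have xk_gt0 : 0 < rnorm (x k - xs) by rewrite lt_def xk0 rnorm_ge0.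
have xp : 0 < rnorm (x k - xs) `^ (p + 1) by rewrite powR_gt0.
rewrite -ler_pdivrMr//.
have := gauss_newton_le k; rewrite le_eqVlt => /predU1P[->|xt]; first exact: lexx.
exact: ltW (majorant_powR_ratio_lt rad_pos L_pos L_int p01 L_mono xk_gt0 xt
  (majorant_seq_lt_nu k)).
Qed.

Lemma gauss_newton_linear_rate : p = 0 ->
  forall k, rnorm (x k - xs) <= t0 * (t 1%N / t0) ^+ k.
Proof.
move=> pE k; elim: k => [|k IH]; first by rewrite expr0 mulr1.
have /andP[h1 h2] := gauss_newton_rate k.
have q0 : 0 <= t 1%N / t0.
  by rewrite divr_ge0 ?rnorm_ge0//; have /andP[/ltW] := majorant_seq_in 1.
rewrite (le_trans (le_trans h1 h2))// pE add0r !powRr1 ?rnorm_ge0//.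
by rewrite exprS mulrCA ler_wpM2l.
Qed.

(** The exponents e_k = ((p+1)^k - 1) / p satisfy e_(k+1) = 1 + (p+1) e_k, which
    is the recursion that the rate inequality produces. *)
Lemma gauss_newton_power_rate : p != 0 ->
  forall k, rnorm (x k - xs) <= t0 * (t 1%N / t0) `^ (((p + 1) ^+ k - 1) / p).
Proof.
move=> pN0 k; have /andP[p0 _] := p01.
have t0p := initial_error_gt0.
elim: k => [|k IH]; first by rewrite expr0 subrr mul0r powRr0 mulr1.
have /andP[h1 h2] := gauss_newton_rate k.
have /andP[t1p _] := majorant_seq_in 1.
have q0 : 0 < t 1%N / t0 by rewrite divr_gt0.
have tp : 0 < t0 `^ (p + 1) by rewrite powR_gt0.
have p10 : 0 <= p + 1 by rewrite addr_ge0.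
rewrite (le_trans (le_trans h1 h2))//.
have h3 : rnorm (x k - xs) `^ (p + 1) <=
    (t0 * (t 1%N / t0) `^ (((p + 1) ^+ k - 1) / p)) `^ (p + 1).
  by rewrite ge0_ler_powR ?nnegrE ?rnorm_ge0// mulr_ge0 ?powR_ge0// ltW.
have c0 : 0 <= t 1%N / t0 `^ (p + 1) by rewrite divr_ge0 ?powR_ge0// ltW.
rewrite (le_trans (ler_wpM2l c0 h3))//.
rewrite powRM ?powR_ge0 ?rnorm_ge0// -powRrM mulrA divfK ?gt_eqF//.
have -> : ((p + 1) ^+ k.+1 - 1) / p = 1 + ((p + 1) ^+ k - 1) / p * (p + 1).
  by rewrite exprS; field.
rewrite [leRHS](_ : _ = t 1%N * (t 1%N / t0) `^ (((p + 1) ^+ k - 1) / p * (p + 1)))//.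
rewrite powRD; last by rewrite (gt_eqF q0) implybT.
by rewrite powRr1 ?ltW// mulrA [t0 * _]mulrC divfK// gt_eqF.
Qed.

End PowerRate.
End GaussNewton.

Theorem theorem15 (R : realType) (s : scalar_kind) (X Y : hilbertType R s)
    (Omega : set X) (F : X -> Y) (xs : X) (rad : R) (L : R -> R)
    (H : newton_hyp Omega F xs rad L) :
  let kap := kappa rad Omega xs in
  let nub := nu L rad in
  let rhob := rho L rad in
  let rb := Num.min kap rhob in
  let sigb := sigma L kap in
  [/\ 0 < nub, 0 < rhob, 0 < rb & 0 < sigb] /\
  (forall x0 : X, oball xs rb x0 -> x0 <> xs ->
    let t0 := rnorm (x0 - xs) in
    let x := gauss_newton F x0 in
    let t := majorant_seq L t0 in
    [/\ gauss_newton_defined Omega F x0,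
        forall k, 1 - intL L 0 (t k) != 0,
        decreasing_seq t,
        forall k, 0 < t k < rb &
        t k @[k --> \oo] --> (0 : R)] /\
    [/\ forall k, oball xs rb (x k),
        x k @[k --> \oo] --> xs,
        forall y, oball xs sigb y -> (F y = 0 <-> y = xs),
        t k.+1 / t k @[k --> \oo] --> (0 : R) &
        rnorm (x k.+1 - xs) / rnorm (x k - xs) @[k --> \oo] --> (0 : R)]) /\
  (intLu L rhob / (rhob * (1 - intL L 0 rhob)) = 1 -> rhob < kap ->
    rb = rhob /\
    exists (s' : scalar_kind) (X' Y' : hilbertType R s') (Omega' : set X')
           (F' : X' -> Y') (xs' x0' : X'),
      [/\ newton_hyp Omega' F' xs' rad L,
          kappa rad Omega' xs' = kap,
          rnorm (x0' - xs') = rhob,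
          gauss_newton_defined Omega' F' x0' &
          ~ cvg (gauss_newton F' x0' k @[k --> \oo])]) /\
  (forall p : R, 0 <= p <= 1 ->
    (forall u v : R, 0 < u -> u <= v -> v < nub ->
       u `^ (1 - p) * L u <= v `^ (1 - p) * L v) ->
    forall x0 : X, oball xs rb x0 -> x0 <> xs ->
    let t0 := rnorm (x0 - xs) in
    let x := gauss_newton F x0 in
    let t := majorant_seq L t0 in
    [/\ decreasing_seq (fun k => t k.+1 / t k `^ (p + 1)),
        forall k,
          rnorm (x k.+1 - xs)
            <= t k.+1 / t k `^ (p + 1) * rnorm (x k - xs) `^ (p + 1)
            <= t 1%N / t0 `^ (p + 1) * rnorm (x k - xs) `^ (p + 1),
        p = 0 -> forall k, rnorm (x k - xs) <= t0 * (t 1%N / t0) ^+ k &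
        p != 0 -> forall k, rnorm (x k - xs)
            <= t0 * (t 1%N / t0) `^ (((p + 1) ^+ k - 1) / p)]).
Proof.
move=> kap nub rhob rb sigb.
have rad0 := rad_gt0 H; have Lpos := L_gt0 H; have Lint := L_integrable H.
have kap0 : 0 < kap := kappa_gt0 H.
have kap_rad : kap <= rad := kappa_le_rad H.
have rho0 : 0 < rhob := rho_gt0 rad0 Lpos Lint.
split.
  split; [exact: (nu_gt0 rad0 Lpos Lint) | exact: rho0 | by rewrite lt_min kap0|].
  exact: (sigma_gt0 rad0 Lpos Lint).
split.
  move=> x0 x0b x0N t0 x t.
  have t0p := initial_error_gt0 x0N.
  have t0r : t0 < rhob := initial_error_lt_rho x0b.
  split; split.
  - exact: (gauss_newton_is_defined H).
  - move=> k; have /andP[tk0 _] := majorant_seq_in H x0b x0N k.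
    rewrite gt_eqF// subr_gt0.
    by apply: (intL0_lt1 Lpos Lint (ltW tk0)); exact: (majorant_seq_lt_nu H).
  - exact: (majorant_seq_decreasing rad0 Lpos Lint).
  - move=> k; have /andP[tk0 tkt] := majorant_seq_in H x0b x0N k.
    by rewrite tk0; apply: le_lt_trans tkt x0b.
  - exact: (majorant_seq_cvg0 rad0 Lpos Lint).
  - exact: (gauss_newton_ball H).
  - exact: (gauss_newton_cvg H).
  - by move=> y yb; split=> [|->]; [exact: (zero_unique H yb)|exact: F_xs H].
  - exact: (majorant_seq_superlinear rad0 Lpos Lint).
  - exact: (gauss_newton_superlinear H).
split.
  move=> rate1 rho_kap; split; first by apply/min_idPr/ltW.
  exists RealScalars, (realLine R), (realLine R), (sharp_domain kap),
    (sharp_map L), 0, (rhob : realLine R).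
  have [def div] := sharp_divergence Lpos Lint kap_rad rho0 rho_kap rate1.
  split => //.
  - exact: sharp_newton_hyp.
  - exact: sharp_kappa.
  - by rewrite subr0 rnorm_realLine gtr0_norm.
move=> p p01 Lmono x0 x0b x0N t0 x t; split.
- exact: (power_rate_decreasing H x0b x0N p01 Lmono).
- exact: (gauss_newton_rate H x0b x0N p01 Lmono).
- exact: (gauss_newton_linear_rate H x0b x0N p01 Lmono).
- exact: (gauss_newton_power_rate H x0b x0N p01 Lmono).
Qed.
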